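(* For every peer arrival rate $\lambda>1$, the encoding parameter $k$ (the number of distinct chunks needed to decode the file) can be chosen so that the peer-to-peer system described in the context, with arrival rate $\lambda$ per slot and parameter $k$, is stable. That is, any workload can be stabilized by a proper selection of $k$.
   Context: Model. Time is slotted; one slot corresponds to the exchange of one chunk. There is a single file and one server. Using a fountain code, the server generates from the file an unlimited sequence of distinct chunks such that any $k$ distinct chunks suffice to decode the file. Peers arrive with on average $\lambda$ arrivals per slot, and the number of arrivals in each slot is greater than $1$ and less than a constant $A>0$. Only $\lambda>1$ is considered. Peers arrive empty (with no chunk). Server policy: the server can push chunks only at rate $1$ (one per slot), and pushes new chunks only to newly arriving peers. The arrival stream is split by independent coin tosses into a stream of rate $1$ (each arrival is selected with probability $1/\lambda$) and a stream of rate $\lambda-1$ (probability $(\lambda-1)/\lambda$). Each peer of the first stream receives on arrival a new (innovative) chunk from the server; each peer of the second stream joins the system empty. Peer policy: in each slot every peer $p$ selects a peer $q$ at random (uniformly) among all other peers in the system. If $q$ holds at least one chunk that $p$ does not hold, $p$ immediately downloads one such chunk, chosen at random among them; otherwise nothing is downloaded. A peer leaves the system as soon as it holds $k$ distinct chunks. The system is a Markov process whose state is the collection of peer chunk profiles (which chunks each present peer holds). ''Stable'' means that this Markov process is positive recurrent. *)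

(* Defs.v *)
From mathcomp Require Import all_boot all_order all_algebra.
From mathcomp Require Import finmap generic_quotient.
From mathcomp Require Import boolp classical_sets reals ereal topology sequences.

Set Implicit Arguments.
Unset Strict Implicit.
Unset Printing Implicit Defensive.

Import Order.TTheory GRing.Theory Num.Theory.

Local Open Scope ring_scope.

(* A finitely supported law is a list of (weight, outcome) pairs; an outcome
   may be listed several times, its weights then add up. *)
Definition fdist (R : realType) (T : Type) : Type := seq (R * T).

Section FiniteLaws.
Context {R : realType}.

Definition ret T (x : T) : fdist R T := [:: (1, x)].

Definition bind T U (d : fdist R T) (f : T -> fdist R U) : fdist R U :=
  flatten [seq [seq (wx.1 * vy.1, vy.2) | vy <- f wx.2] | wx <- d].

Definition uniform T (x0 : T) (s : seq T) : fdist R T :=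
  if s is [::] then ret x0 else [seq ((size s)%:R^-1, x) | x <- s].

(* The joint law of independent draws from the laws in [ds]. *)
Definition independent T (ds : seq (fdist R T)) : fdist R (seq T) :=
  foldr (fun d e => bind d (fun x => bind e (fun s => ret (x :: s))))
        (ret [::]) ds.

Definition expect T (d : fdist R T) (f : T -> R) : R :=
  \sum_(wx <- d) wx.1 * f wx.2.

Definition prob T (d : fdist R T) (B : set T) : R :=
  expect d (fun x => (x \in B)%:R).

End FiniteLaws.

Section MarkovChains.
Context {R : realType} {S : Type}.
Variable step : S -> fdist R S.

Definition nstep (n : nat) (x : S) : fdist R S :=
  iter n (fun d => bind d step) (ret x).

Definition accessible (x y : S) : Prop :=
  exists n, 0 < prob (nstep n x) [set y]%classic.

(* [first_passage B n x] is the probability, starting from [x], that the first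
   time t >= 1 at which the chain is in [B] equals n + 1. *)
Fixpoint first_passage (B : set S) (n : nat) (x : S) : R :=
  if n is m.+1
  then expect (step x) (fun z => if z \in B then 0 else first_passage B m z)
  else prob (step x) B.

Definition hitting_prob (B : set S) (x : S) : \bar R :=
  (\sum_(n <oo) (first_passage B n x)%:E)%E.

(* This is the mean hitting time when [hitting_prob B x = 1]. *)
Definition mean_hitting_time (B : set S) (x : S) : \bar R :=
  (\sum_(n <oo) (n.+1%:R * first_passage B n x)%:E)%E.

Definition positive_recurrent_state (x : S) : Prop :=
  hitting_prob [set x]%classic x = 1%E /\
  (mean_hitting_time [set x]%classic x < +oo)%E.

(* The state space may contain transient states (here, the system without any
   peer), so irreducibility is not demanded of the whole space: there is a
   closed communicating class, all of whose states are positive recurrent, and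
   which is entered almost surely from every initial state. *)
Definition positive_recurrent : Prop :=
  exists C : set S,
    [/\ (C !=set0)%classic,
        forall x y, C x -> (C y <-> accessible x y),
        forall x, C x -> positive_recurrent_state x
      & forall x, hitting_prob C x = 1%E].

End MarkovChains.

(* Chunks are labelled by natural numbers, a profile is the set of chunks held
   by a peer, and a configuration lists the profiles of the present peers.
   Configurations having a profile with k or more chunks are unreachable and
   transient: [slot] discards such profiles before any exchange. *)
Definition profile := {fset nat}.
Definition config := seq profile.

Definition rename (f : nat -> nat) (x : config) : config :=
  [seq (f @` X)%fset | X : profile <- x].

(* The chunks pushed by the server never occurred before, so a labelled
   configuration containing chunks would never recur: a state of the system is
   a configuration up to the order of the peers and a renaming of the chunks. *)
Definition same_state : rel config :=
  fun x y => `[< exists2 f, bijective f & perm_eq (rename f x) y >].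

Lemma rename_comp f g x : rename g (rename f x) = rename (g \o f) x.
Proof.
rewrite /rename -map_comp; apply: eq_map => X /=.
by rewrite [RHS]imfset_comp.
Qed.

Lemma rename_id f x : f =1 id -> rename f x = x.
Proof.
move=> fid; rewrite -[RHS]map_id; apply: eq_map => X.
apply/fsetP => c; apply/imfsetP/idP => [[d dX ->]|cX]; first by rewrite fid.
by exists c => //; rewrite fid.
Qed.

Lemma same_state_refl : reflexive same_state.
Proof.
move=> x; apply/asboolP; exists id; first by exists id.
by rewrite rename_id.
Qed.

Lemma same_state_sym : symmetric same_state.
Proof.
have H x y : same_state x y -> same_state y x.
  move=> /asboolP[f [g fK gK] xy]; apply/asboolP; exists g; first by exists f.
  by rewrite perm_sym -(@rename_id (g \o f) x fK) -rename_comp perm_map.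
by move=> x y; apply/idP/idP; exact: H.
Qed.

Lemma same_state_trans : transitive same_state.
Proof.
move=> y x z /asboolP[f fb xy] /asboolP[g gb yz]; apply/asboolP.
exists (g \o f); first exact: bij_comp.
by rewrite -rename_comp; apply: perm_trans yz; exact: perm_map.
Qed.

Canonical same_state_equiv :=
  EquivRel same_state same_state_refl same_state_sym same_state_trans.

Definition state := {eq_quot same_state}%qT.

Section System.
Context {R : realType}.
(* [k] chunks decode the file; [lambda] is the arrival rate; [mu n] is the
   probability of [n] arrivals in a slot, with [n < A]. *)
Variables (k : nat) (lambda : R) (A : nat) (mu : nat -> R).

Definition arrival_law : Prop :=
  [/\ forall n, 0 <= mu n,
      forall n, mu n != 0 -> (1 < n < A)%N,
      \sum_(n < A) mu n = 1
    & \sum_(n < A) n%:R * mu n = lambda].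

Definition arrivals : fdist R nat := [seq (mu n, n) | n <- iota 0 A].

(* A label larger than those of all chunks present in [x]. *)
Definition fresh (x : config) : nat := (\max_(X <- x) \max_(c <- X) c).+1.

Definition newcomer (c : nat) : fdist R profile :=
  [:: (lambda^-1, [fset c]%fset); ((lambda - 1) / lambda, fset0)].

Definition newcomers (x : config) (n : nat) : fdist R config :=
  independent [seq newcomer (fresh x + i)%N | i <- iota 0 n].

Definition leave (x : config) : config :=
  [seq X : profile <- x | (#|` X| < k)%N].

(* New profile of a peer with profile [X] that selected a peer with profile
   [Y]. *)
Definition download (X Y : profile) : fdist R profile :=
  uniform X [seq (c |` X)%fset | c <- (Y `\` X)%fset].

(* New profile of the [i]-th peer of [y]. A peer that is alone in the system
   keeps its profile. *)
Definition contact (y : config) (i : nat) : fdist R profile :=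
  let X := nth fset0 y i in
  bind (uniform X (take i y ++ drop i.+1 y)) (download X).

(* All exchanges of a slot are simultaneous: what a peer can upload is what it
   holds at the beginning of the exchange. *)
Definition exchange (y : config) : fdist R config :=
  independent [seq contact y i | i <- iota 0 (size y)].

Definition slot (x : config) : fdist R config :=
  bind arrivals (fun n =>
  bind (newcomers x n) (fun s =>
  bind (exchange (leave (x ++ s))) (fun z =>
  ret (leave z)))).

(* The law of the next state does not depend on the representative: [slot]
   commutes with renaming the chunks and reordering the peers. *)
Definition p2p_chain (s : state) : fdist R state :=
  bind (slot (repr s)) (fun y => ret (\pi_state%qT y)).

Definition stable : Prop := positive_recurrent p2p_chain.

End System.

(* Main.v *)
(* The work of a state is the number of missing chunks. Over T slots, for T a
   constant, its mean decreases by at least 1 from every state with many peers,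
   which is a Foster criterion.
   If the number of ordered pairs of peers in which the second one is useful to
   the first one exceeds a large multiple of the number of peers, then a single
   slot is enough. Otherwise all but boundedly many peers form a club holding
   one and the same set S. During T slots a newcomer then selects members of
   the club with high probability, and by symmetry a peer is selected by one
   other peer per slot in the mean; so a peer carrying a fresh chunk uploads one
   chunk per slot to the club. If |S| < k - 1 such a carrier never leaves, and the uploads grow
   quadratically in T; if |S| = k - 1 it stays for k - 1 slots, which together
   with the downloads by the newcomers makes (lambda + 1)(k - 1) exchanges per
   slot against lambda k - 1 chunks in demand, and lambda < k suffices.
   Irreducibility: a slot may push a single chunk which everybody downloads from
   its carrier; after k such slots the initial peers have left, and the state does
   not depend on them. *)
Require Import Defs.
From mathcomp Require Import all_boot all_order all_algebra.
From mathcomp Require Import finmap generic_quotient.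
From mathcomp Require Import boolp classical_sets reals ereal topology sequences normedtype.
From mathcomp Require Import ring lra zify.

Set Implicit Arguments.
Unset Strict Implicit.
Unset Printing Implicit Defensive.

Import Order.TTheory GRing.Theory Num.Theory numFieldNormedType.Exports.

Local Open Scope fset_scope.
Local Open Scope ring_scope.

(** * Finitely supported laws and their moments *)

Section Laws.
Context {R : realType}.
Implicit Types T U : Type.

Definition nonneg T (d : fdist R T) := all (fun wx => 0 <= wx.1) d.

Definition is_law T (d : fdist R T) := nonneg d /\ expect d (fun=> 1) = 1.

Definition surely T (P : pred T) (d : fdist R T) := all (fun wx => P wx.2) d.

Lemma eq_expect T (d : fdist R T) f g : f =1 g -> expect d f = expect d g.
Proof. by move=> fg; apply: eq_bigr => i _; rewrite fg. Qed.

Lemma expect_ret T (x : T) (f : T -> R) : expect (ret x) f = f x.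
Proof. by rewrite /expect /ret big_seq1 mul1r. Qed.

Lemma expect_bind T U (d : fdist R T) (f : T -> fdist R U) g :
  expect (bind d f) g = expect d (fun x => expect (f x) g).
Proof.
rewrite /expect /bind big_flatten big_map; apply: eq_bigr => wx _.
by rewrite big_map mulr_sumr; apply: eq_bigr => vy _; rewrite mulrA.
Qed.

Lemma expectD T (d : fdist R T) f g :
  expect d (fun x => f x + g x) = expect d f + expect d g.
Proof. by rewrite -big_split; apply: eq_bigr => i _; rewrite mulrDr. Qed.

Lemma expectZ T (d : fdist R T) a f :
  expect d (fun x => a * f x) = a * expect d f.
Proof. by rewrite mulr_sumr; apply: eq_bigr => i _; rewrite mulrCA. Qed.

Lemma expectN T (d : fdist R T) f :
  expect d (fun x => - f x) = - expect d f.
Proof. by rewrite -sumrN; apply: eq_bigr => i _; rewrite mulrN. Qed.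

Lemma expectB T (d : fdist R T) f g :
  expect d (fun x => f x - g x) = expect d f - expect d g.
Proof. by rewrite expectD expectN. Qed.

Lemma expect_cst T (d : fdist R T) a : is_law d -> expect d (fun=> a) = a.
Proof.
by case=> _ d1; rewrite -[RHS]mulr1 -d1 -expectZ; apply: eq_expect => x /=; rewrite mulr1.
Qed.

Lemma le_expect_on T (P : pred T) (d : fdist R T) f g :
  nonneg d -> surely P d -> (forall x, P x -> f x <= g x) ->
  expect d f <= expect d g.
Proof.
rewrite /expect; elim: d => [|wx d IH] /=; first by rewrite !big_nil.
case/andP=> w0 dn /andP[Px dP] fg.
by rewrite !big_cons lerD ?IH// ler_wpM2l// fg.
Qed.

Lemma le_expect T (d : fdist R T) f g :
  nonneg d -> (forall x, f x <= g x) -> expect d f <= expect d g.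
Proof. by move=> dn fg; apply: (@le_expect_on _ predT) => //; exact: all_predT. Qed.

Lemma expect_ge0 T (d : fdist R T) f :
  nonneg d -> (forall x, 0 <= f x) -> 0 <= expect d f.
Proof.
move=> dn f0; have <- : expect d (fun=> 0) = 0.
  by apply: big1 => i _; rewrite mulr0.
exact: le_expect.
Qed.

Lemma expect_le_cst T (P : pred T) (d : fdist R T) f a :
  is_law d -> surely P d -> (forall x, P x -> f x <= a) -> expect d f <= a.
Proof.
move=> dl dP fa; rewrite -[leRHS](expect_cst _ dl).
by apply: le_expect_on fa => //; case: dl.
Qed.

Lemma nonneg_bind T U (d : fdist R T) (f : T -> fdist R U) :
  nonneg d -> (forall x, nonneg (f x)) -> nonneg (bind d f).
Proof.
rewrite /nonneg /bind => dn fn; elim: d dn => //= wx d IH /andP[w0 dn].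
rewrite all_cat IH// andbT all_map; apply: sub_all (fn wx.2) => vy /= v0.
exact: mulr_ge0.
Qed.

Lemma surely_bind T U (P : pred T) (Q : pred U) (d : fdist R T) f :
  surely P d -> (forall x, P x -> surely Q (f x)) -> surely Q (bind d f).
Proof.
rewrite /surely /bind => dP fQ; elim: d dP => //= wx d IH /andP[Px dP].
by rewrite all_cat IH// andbT all_map; apply: sub_all (fQ _ Px) => vy.
Qed.

Lemma law_ret T (x : T) : is_law (ret x : fdist R T).
Proof. by split; rewrite ?expect_ret//= /nonneg /= ler01. Qed.

Lemma law_bind T U (d : fdist R T) (f : T -> fdist R U) :
  is_law d -> (forall x, is_law (f x)) -> is_law (bind d f).
Proof.
move=> dl fl; split; first by apply: nonneg_bind => [|x]; [case: dl|case: (fl x)].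
rewrite expect_bind -[RHS](expect_cst _ dl); apply: eq_expect => x.
by case: (fl x).
Qed.

Lemma law_uniform T (x : T) s : is_law (uniform x s : fdist R T).
Proof.
case: s => [|y s]; first exact: law_ret.
rewrite /uniform; split.
  rewrite /nonneg all_map (eq_all (a2 := predT)) ?all_predT// => z /=.
  by rewrite invr_ge0 ler0n.
rewrite /expect big_map /= big_const_seq count_predT iter_addr_0 mulr1.
by rewrite -(mulr_natr (_^-1)) mulVf// pnatr_eq0.
Qed.

Lemma law_independent T (ds : seq (fdist R T)) :
  (forall d, List.In d ds -> is_law d) -> is_law (independent ds).
Proof.
elim: ds => [|d ds IH] dl; first exact: law_ret.
apply: law_bind => [|x]; first by apply: dl; left.
by apply: law_bind => [|s]; [apply: IH => e ?; apply: dl; right|exact: law_ret].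
Qed.

Lemma surely_size_independent T (ds : seq (fdist R T)) :
  surely (fun s => size s == size ds) (independent ds).
Proof.
elim: ds => [|d ds IH]; first by [].
apply: (@surely_bind _ _ predT) => [|x _]; first exact: all_predT.
apply: surely_bind IH _ => s /eqP sE.
by rewrite /surely /= sE andbT.
Qed.

(* Only marginals matter for additive functionals. *)
Lemma expect_independent_sum T (ds : seq (fdist R T)) (f : T -> R) :
  (forall d, List.In d ds -> is_law d) ->
  expect (independent ds) (fun s => \sum_(x <- s) f x) =
  \sum_(d <- ds) expect d f.
Proof.
elim: ds => [|d ds IH] dl; first by rewrite expect_ret !big_nil.
have dsl e : List.In e ds -> is_law e by move=> ?; apply: dl; right.
rewrite big_cons -(IH dsl) expect_bind.
under eq_expect => x.
  rewrite expect_bind; under eq_expect => s do rewrite expect_ret big_cons.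
  rewrite expectD expect_cst; last exact: law_independent.
  over.
by rewrite expectD expect_cst//; apply: dl; left.
Qed.

(** The variance of a sum of independent indicators is at most its mean, so the second moment is at
    most the squared mean plus the mean. This bound is monotone in the mean, hence an upper bound
    [a] of the mean suffices. *)
Lemma expect_independent_sqr T (ds : seq (fdist R T)) (P : pred T) a :
  (forall d, List.In d ds -> is_law d) ->
  \sum_(d <- ds) expect d (fun x => (P x)%:R) <= a ->
  expect (independent ds) (fun s => (\sum_(x <- s) (P x)%:R) ^+ 2) <=
  a ^+ 2 + a.
Proof.
move=> dl le_a.
set b := \sum_(d <- ds) expect d _ in le_a.
have b0 : 0 <= b.
  rewrite /b; elim: ds {b le_a} dl => [|d ds IH] dl; rewrite ?big_nil// big_cons.
  apply: addr_ge0; last by apply: IH => e ?; apply: dl; right.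
  by apply: expect_ge0 => //; case: (dl d) => //; left.
suff H : expect (independent ds) (fun s => (\sum_(x <- s) (P x)%:R) ^+ 2) <=
         b ^+ 2 + b.
  by apply: le_trans H _; rewrite lerD// lerXn2r// nnegrE// (le_trans b0).
rewrite /b; elim: ds {b b0 le_a} dl => [|d ds IH] dl.
  by rewrite expect_ret !big_nil expr0n addr0.
have dsl e : List.In e ds -> is_law e by move=> ?; apply: dl; right.
have dl0 : is_law d by apply: dl; left.
have := IH dsl; rewrite big_cons; set q := \sum_(e <- ds) _.
rewrite expect_bind; set p := expect d (fun x => (P x)%:R) => IHq.
set g := fun s : seq T => \sum_(x <- s) (P x)%:R : R.
have gq : expect (independent ds) g = q by exact: expect_independent_sum.
under eq_expect => x.
  rewrite expect_bind.
  under eq_expect => s.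
    rewrite expect_ret big_cons -/(g s).
    have -> : ((P x)%:R + g s) ^+ 2 = (P x)%:R + ((2 * (P x)%:R) * g s + g s ^+ 2).
      by case: (P x); rewrite /=; ring.
    over.
  rewrite !expectD expectZ expect_cst; last exact: law_independent.
  rewrite gq mulrAC.
  over.
rewrite !expectD expectZ expect_cst// -/p.
have p0 : 0 <= p by apply: expect_ge0 => //; case: dl0.
nra.
Qed.
End Laws.

(** * Lower bounds on the probability of a prescribed outcome *)

Section MoreLaws.
Context {R : realType}.
Implicit Types T U : Type.

Lemma in_set1_refl T (x : T) : (x \in [set x]%classic) = true.
Proof. exact: mem_set. Qed.

Lemma prob_bind_ge T U (d : fdist R T) (f : T -> fdist R U) x B p q :
  nonneg d -> (forall z, nonneg (f z)) -> 0 <= q ->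
  p <= prob d [set x]%classic -> q <= prob (f x) B ->
  p * q <= prob (bind d f) B.
Proof.
move=> dn fn q0 pd qf; rewrite /prob expect_bind.
apply: (@le_trans _ _ (expect d (fun z => q * (z \in [set x]%classic)%:R))).
  by rewrite expectZ mulrC ler_wpM2l.
apply: le_expect => // z; case: (boolP (z \in [set x]%classic)) => zx.
  by rewrite mulr1; move: zx; rewrite inE => ->.
by rewrite mulr0; apply: expect_ge0.
Qed.

Lemma prob_ret T (x : T) (B : set T) :
  prob (ret x : fdist R T) B = (x \in B)%:R.
Proof. by rewrite /prob expect_ret. Qed.

Lemma prob_uniform_ge (T : eqType) (x y : T) s :
  y \in s -> (size s)%:R^-1 <= prob (uniform x s : fdist R T) [set y]%classic.
Proof.
case: s => // z s; rewrite /prob /expect /uniform big_map /= => ys.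
rewrite -mulr_sumr -[leLHS]mulr1 ler_wpM2l ?invr_ge0//.
rewrite (big_rem y ys) /= in_set1_refl -[leLHS]addr0 lerD//.
by apply: sumr_ge0.
Qed.

Lemma prob_independent_ge (T : Type) (ds : seq (fdist R T)) xs q :
  0 <= q -> List.Forall2 (fun d x => q <= prob d [set x]%classic) ds xs ->
  (forall d, List.In d ds -> nonneg d) ->
  q ^+ size ds <= prob (independent ds) [set xs]%classic.
Proof.
move=> q0; elim=> [|d x {}ds {}xs qd _ IH] dn.
  by rewrite prob_ret expr0 in_set1_refl.
have dsn e : List.In e ds -> nonneg e by move=> ?; apply: dn; right.
have isn : nonneg (independent ds).
  elim: {+}ds dsn => [|e es IHe] en; first by rewrite /nonneg /= ler01.
  apply: nonneg_bind => [|z]; first by apply: en; left.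
  by apply: nonneg_bind => [|s]; [apply: IHe => ? ?; apply: en; right|rewrite /nonneg /= ler01].
rewrite exprS.
apply: (@prob_bind_ge _ _ _ _ x) => //; first by apply: dn; left.
- by move=> z; apply: nonneg_bind => // s; rewrite /nonneg /= ler01.
- exact: exprn_ge0.
rewrite -[leLHS]mulr1; apply: (@prob_bind_ge _ _ _ _ xs) => //.
- by move=> s; rewrite /nonneg /= ler01.
- exact: IH.
by rewrite prob_ret in_set1_refl.
Qed.

End MoreLaws.

(** * A Foster criterion with reachability of a reference state *)

Section Foster.
Context {R : realType} {S : Type}.
Variable step : S -> fdist R S.
Hypothesis step_law : forall x, is_law (step x).

Let stepn x : nonneg (step x). Proof. by case: (step_law x). Qed.

Definition transition (f : S -> R) (x : S) : R := expect (step x) f.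

Lemma law_nstep n x : is_law (nstep step n x).
Proof. by elim: n => [|n IH]; [exact: law_ret|exact: law_bind]. Qed.

Lemma expect_nstep n x f : expect (nstep step n x) f = iter n transition f x.
Proof.
elim: n f => [|n IH] f; first by rewrite expect_ret.
by rewrite iterSr -IH /= expect_bind.
Qed.

Lemma expect_nstepD m n x f :
  expect (nstep step (m + n) x) f =
  expect (nstep step m x) (fun y => expect (nstep step n y) f).
Proof.
rewrite !expect_nstep iterD; congr (iter m _ _ _).
by apply/funext => y; rewrite expect_nstep.
Qed.

Lemma prob_nstepD m n x y (B : set S) p q : 0 <= q ->
  p <= prob (nstep step m x) [set y]%classic -> q <= prob (nstep step n y) B ->
  p * q <= prob (nstep step (m + n) x) B.
Proof.
move=> q0 px qy; rewrite /prob expect_nstepD.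
have -> : expect (nstep step m x)
    (fun z => expect (nstep step n z) (fun w => (w \in B)%:R)) =
  prob (bind (nstep step m x) (nstep step n)) B by rewrite /prob expect_bind.
apply: prob_bind_ge px qy => //; first by case: (law_nstep m x).
by move=> z; case: (law_nstep n z).
Qed.

Lemma accessible_trans x y z :
  accessible step x y -> accessible step y z -> accessible step x z.
Proof.
move=> [m px] [n py]; exists (m + n)%N; apply: lt_le_trans (mulr_gt0 px py) _.
by apply: prob_nstepD (lexx _) (lexx _); exact: ltW.
Qed.

Variable B : set S.

(** The test comes after the step, so that a start in [B] does not count: [survival n x] is the
    probability that the times 1 to n all avoid [B]. *)
Definition killed (f : S -> R) (x : S) : R :=
  expect (step x) (fun z => if z \in B then 0 else f z).

Definition survival n : S -> R := iter n killed (fun=> 1).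

Lemma killed_le f g : (forall x, f x <= g x) -> forall x, killed f x <= killed g x.
Proof. by move=> fg x; apply: le_expect => // z; case: ifP. Qed.

Lemma iter_killed_le n f g : (forall x, f x <= g x) ->
  forall x, iter n killed f x <= iter n killed g x.
Proof. by elim: n => //= n IH fg x; apply: killed_le => y; apply: IH. Qed.

Lemma killed_lin a f g : killed (fun x => a * f x + g x) =
  fun x => a * killed f x + killed g x.
Proof.
apply/funext => x; rewrite /killed -expectZ -expectD; apply: eq_expect => z.
by case: ifP => _; rewrite ?mulr0 ?addr0.
Qed.

Lemma iter_killed_lin n a f g : iter n killed (fun x => a * f x + g x) =
  fun x => a * iter n killed f x + iter n killed g x.
Proof. by elim: n => //= n ->; rewrite killed_lin. Qed.

Lemma iter_killed_ge0 n f : (forall x, 0 <= f x) -> forall x, 0 <= iter n killed f x.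
Proof.
by elim: n => //= n IH f0 x; apply: expect_ge0 => // z; case: ifP => // _; exact: IH.
Qed.

Lemma iter_killed_transition n f : (forall x, 0 <= f x) ->
  forall x, iter n killed f x <= iter n transition f x.
Proof.
move=> f0; elim: n => //= n IH x; apply: le_expect => // z; case: ifP => // _.
apply: le_trans (IH z); exact: iter_killed_ge0.
Qed.

Lemma survival_ge0 n x : 0 <= survival n x.
Proof. by apply: iter_killed_ge0 => ?; exact: ler01. Qed.

Lemma survival_le n x : survival n.+1 x <= survival n x.
Proof.
rewrite /survival iterSr; apply: iter_killed_le => y.
by rewrite -[leRHS](expect_cst _ (step_law y)); apply: le_expect => // z; case: ifP.
Qed.

Lemma survival_homo m n x : (m <= n)%N -> survival n x <= survival m x.
Proof.
move=> mn; rewrite -(subnK mn); elim: (n - m)%N => // i IH.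
by rewrite addSn; apply: le_trans IH; exact: survival_le.
Qed.

Lemma survival_le1 n x : survival n x <= 1.
Proof. exact: (@survival_homo 0). Qed.

Lemma killed1 x : killed (fun=> 1) x = 1 - prob (step x) B.
Proof.
rewrite -[X in X - _](expect_cst 1 (step_law x)) -expectB; apply: eq_expect => z.
by case: (z \in B); rewrite ?subrr ?subr0.
Qed.

(** To survive, the chain must in particular be outside [B] at the last time; the earlier tests are
    dropped. *)
Lemma survival_le_prob n x : survival n.+1 x <= 1 - prob (nstep step n.+1 x) B.
Proof.
rewrite /survival iterSr.
apply: le_trans (iter_killed_transition _ _ _) _.
  by move=> y; apply: expect_ge0 => // z; case: ifP.
rewrite -expect_nstep /prob -addn1 expect_nstepD -[leRHS]/(_ - expect _ _).
rewrite -[X in X - _](expect_cst 1 (law_nstep n x)) -expectB.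
apply: le_expect => [|y]; first by case: (law_nstep n x).
by rewrite killed1 /prob expect_nstep.
Qed.

Lemma first_passageE n x :
  first_passage step B n x = survival n x - survival n.+1 x.
Proof.
elim: n x => [|n IH] x /=; first by rewrite /survival /= killed1 opprB addrCA subrr addr0.
rewrite -expectB; apply: eq_expect => z.
by case: ifP => _; rewrite ?subrr// IH.
Qed.

Lemma first_passage_ge0 n x : 0 <= first_passage step B n x.
Proof. by rewrite first_passageE subr_ge0 survival_le. Qed.

Lemma sum_first_passage n x :
  \sum_(0 <= i < n) first_passage step B i x = 1 - survival n x.
Proof.
elim: n => [|n IH]; first by rewrite big_geq// subrr.
by rewrite big_nat_recr//= IH first_passageE addrA subrK.
Qed.

(** Summation by parts. *)
Lemma sum_weighted_first_passage n x :
  \sum_(0 <= i < n) i.+1%:R * first_passage step B i x =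
  \sum_(0 <= i < n) survival i x - n%:R * survival n x.
Proof.
elim: n => [|n IH]; first by rewrite !big_geq// mul0r subrr.
rewrite !big_nat_recr//= IH first_passageE -natr1.
by rewrite -[killed _ x]/(survival n.+1 x); ring.
Qed.

(** Survival is nonincreasing, so [n%:R * survival n x] is at most [U]; thus survival tends to 0 and
    [B] is hit almost surely. Summation by parts then bounds the mean hitting time by [U]. *)
Lemma survival_summable x U :
    (forall n, \sum_(0 <= i < n) survival i x <= U) ->
  hitting_prob step B x = 1%E /\ (mean_hitting_time step B x < +oo)%E.
Proof.
move=> leU; split.
  have U0 : 0 <= U by apply: le_trans (leU 0%N); rewrite big_geq.
  have ns n : n%:R * survival n x <= U.
    apply: le_trans (leU n).
    have -> : n%:R * survival n x = \sum_(0 <= i < n) survival n x.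
      by rewrite sumr_const_nat subn0 mulr_natl.
    by apply: ler_sum_nat => i /andP[_ /ltnW]; exact: survival_homo.
  apply/cvg_lim => //.
  rewrite (_ : (fun n => _) = fun n => (1 - survival n x)%:E); last first.
    by apply/funext => n; rewrite sumEFin sum_first_passage.
  apply: cvg_EFin; first by apply: nearW.
  rewrite -[X in (_ --> X)%classic]subr0; apply: cvgB; first exact: cvg_cst.
  apply/cvgrPdist_le => e e0; near=> n.
  rewrite sub0r normrN ger0_norm ?survival_ge0//.
  have n0 : (0 : R) < n%:R by rewrite ltr0n; near: n; exists 1%N.
  rewrite -(ler_pM2l n0) (le_trans (ns n))// -ler_pdivrMr//.
  near: n; exact: nbhs_infty_ger.
have nn n : (0 <= (n.+1%:R * first_passage step B n x)%:E)%E.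
  by rewrite lee_fin mulr_ge0// first_passage_ge0.
rewrite (@le_lt_trans _ _ U%:E) ?ltry//.
apply: lime_le; first by apply: is_cvg_nneseries.
apply: nearW => n; rewrite sumEFin lee_fin sum_weighted_first_passage.
by rewrite lerBlDr (le_trans (leU n))// lerDl mulr_ge0// survival_ge0.
Unshelve. all: by end_near.
Qed.

Variables (T m : nat) (V : S -> R) (F : set S) (b delta : R).
Hypothesis T_gt0 : (0 < T)%N.
Hypothesis V_ge0 : forall x, 0 <= V x.
Hypothesis b_ge0 : 0 <= b.
Hypothesis delta_gt0 : 0 < delta.
Hypothesis drift : forall x,
  expect (nstep step T x) V <= V x - 1 + b * (x \in F)%:R.
Hypothesis hit : forall x, F x -> survival m x <= 1 - delta.

Let Q := iter T killed.
Let oneF : S -> R := fun x => (x \in F)%:R.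

Let Q_sum n (f : nat -> S -> R) x :
  Q (fun y => \sum_(i < n) f i y) x = \sum_(i < n) Q (f i) x.
Proof.
elim: n f x => [|n IH] f x.
  rewrite big_ord0 /Q.
  under eq_fun do rewrite big_ord0.
  (* Linearity with a = -1 and f = g = 0 shows that the zero function is sent to itself. *)
  have := congr1 (@^~ x) (iter_killed_lin T (-1) (fun=> 0) (fun=> 0)).
  by rewrite mulr0 addr0 /= => ->; rewrite mulN1r addNr.
rewrite big_ord_recr /= -IH /Q addrC.
under eq_fun do rewrite big_ord_recr /= addrC -[f _ _]mul1r.
by rewrite iter_killed_lin mul1r.
Qed.

Let Q_iter j f : iter j Q f = iter (j * T) killed f.
Proof. by elim: j => //= j ->; rewrite mulSn iterD. Qed.

(* On [F], [delta <= 1 - Q^m 1], and the sum of the [Q^j (1 - Q^m 1)]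
   telescopes. *)
Let visits n x : delta * \sum_(j < n) iter j Q oneF x <= m%:R.
Proof.
apply: (@le_trans _ _ (\sum_(j < n) (survival (j * T) x - survival (j * T + m) x))).
  rewrite mulr_sumr; apply: ler_sum => j _; rewrite Q_iter /survival iterD.
  have -> : delta * iter (j * T) killed oneF x =
            iter (j * T) killed (fun y => delta * oneF y + 0) x.
    rewrite iter_killed_lin.
    have := congr1 (@^~ x) (iter_killed_lin (j * T) (-1) (fun=> 0) (fun=> 0)).
    by rewrite mulr0 addr0 /= => ->; rewrite mulN1r addNr addr0.
  have := congr1 (@^~ x) (iter_killed_lin (j * T) (-1) (iter m killed (fun=> 1)) (fun=> 1)).
  rewrite /= mulN1r addrC => <-; apply: iter_killed_le => y.
  rewrite addr0 mulN1r /oneF; case: (boolP (y \in F)) => yF; last first.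
    by rewrite mulr0 addrC subr_ge0; exact: survival_le1.
  rewrite mulr1 addrC; move: yF; rewrite inE => /hit; rewrite /survival; lra.
suff H p : \sum_(j < n) (survival (j * T) x - survival (j * T + p) x) <= p%:R.
  exact: H.
elim: p => [|p IH].
  by rewrite big1// => i _; rewrite addn0 subrr.
(* The j-th term is the probability that the first passage occurs at time jT + p + 1. These times
   are distinct because T > 0, so the events are disjoint. *)
have le1 : \sum_(j < n) (survival (j * T + p) x - survival (j * T + p.+1) x) <= 1.
  have : forall N, \sum_(0 <= i < N) (survival i x - survival i.+1 x) <= 1.
    move=> N; under eq_bigr do rewrite -first_passageE.
    by rewrite sum_first_passage lerBlDr lerDl survival_ge0.
  move=> /(_ (n * T + p)%N); apply: le_trans.
  elim: n {IH} => [|n0 IHn].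
    rewrite big_ord0; apply: sumr_ge0 => i _; rewrite subr_ge0; exact: survival_le.
  rewrite big_ord_recr/= (@big_cat_nat _ _ _ (n0 * T + p)%N)//=; last first.
    by rewrite leq_add2r leq_mul2r leqnSn orbT.
  rewrite lerD//.
  have lt : (n0 * T + p < n0.+1 * T + p)%N by rewrite ltn_add2r ltn_mul2r T_gt0 ltnSn.
  rewrite big_ltn// addnS -[leLHS]addr0 lerD//; apply: sumr_ge0 => i _.
  by rewrite subr_ge0 survival_le.
rewrite -natr1; apply: le_trans (lerD IH le1); rewrite -big_split /=.
by apply: ler_sum => j _; rewrite addrA subrK.
Qed.

(** Killing only lowers the mean of [V], so [Q V] is at most [V - 1 + b * oneF]. Iterating bounds
    the sum of the [Q^j 1] by [V] plus [b] times the mean number of visits to [F] before [B], which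
    [visits] controls. Monotonicity of survival fills in the times between multiples of [T], at the
    cost of a factor [T]. *)
Lemma foster_survival x : exists U, forall n, \sum_(0 <= i < n) survival i x <= U.
Proof.
have bound n y : \sum_(j < n) iter j Q (fun=> 1) y <=
                 V y + b * \sum_(j < n) iter j Q oneF y.
  elim: n y => [|n IH] y; first by rewrite !big_ord0 mulr0 addr0.
  rewrite !big_ord_recl /=.
  rewrite (_ : \sum_(i < n) _ = Q (fun y => \sum_(i < n) iter i Q (fun=> 1) y) y); last first.
    by rewrite Q_sum.
  apply: (@le_trans _ _ (1 + Q (fun y => b * \sum_(j < n) iter j Q oneF y + V y) y)).
    by rewrite lerD2l; apply: iter_killed_le => z; rewrite addrC.
  rewrite /Q iter_killed_lin -/Q Q_sum.
  have := iter_killed_transition T V_ge0 y; rewrite -/Q -expect_nstep.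
  have := drift y; rewrite /oneF; lra.
exists (T%:R * (V x + b * (m%:R / delta))) => n.
apply: (@le_trans _ _ (\sum_(0 <= i < n * T) survival i x)).
  have nT : (n <= n * T)%N by rewrite leq_pmulr.
  rewrite [leRHS](@big_cat_nat _ _ _ n)//= lerDl; apply: sumr_ge0 => i _; exact: survival_ge0.
apply: (@le_trans _ _ (T%:R * \sum_(j < n) iter j Q (fun=> 1) x)).
  elim: n => [|n IH]; first by rewrite big_ord0 mulr0 big_geq.
  rewrite big_ord_recr mulrDr/= (@big_cat_nat _ _ _ (n * T)%N)//=; last first.
    by rewrite leq_mul2r leqnSn orbT.
  rewrite lerD// Q_iter.
  have -> : T = (n.+1 * T - n * T)%N by rewrite mulSn addnK.
  rewrite mulrC mulr_natr -sumr_const_nat mulSn addnK.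
  by apply: ler_sum_nat => i /andP[ni _]; exact: survival_homo.
rewrite ler_wpM2l//; apply: le_trans (bound n x) _; rewrite lerD2l ler_wpM2l//.
by rewrite ler_pdivlMr// mulrC visits.
Qed.

End Foster.

(** The closed class consists of the states accessible from [z]. If [z] reaches [B] in n steps with
    positive probability, then [F] reaches it within m + 1 + n steps with a uniformly positive one,
    so [foster_survival] applies to [B] from every initial state; this covers both the recurrence of
    each state of the class and the entrance into the class. *)
Theorem foster_positive_recurrent (R : realType) (S : Type)
    (step : S -> fdist R S) (T m : nat) (V : S -> R) (F : set S) (b p : R)
    (z : S) :
  (forall x, is_law (step x)) -> (0 < T)%N -> (forall x, 0 <= V x) -> 0 <= b ->
  (forall x, expect (nstep step T x) V <= V x - 1 + b * (x \in F)%:R) ->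
  0 < p -> (forall x, F x -> p <= prob (nstep step m.+1 x) [set z]%classic) ->
  (forall x, accessible step x z) ->
  positive_recurrent step.
Proof.
move=> step_law T0 V0 b0 drift p0 Fz accz.
have hit B n : 0 < prob (nstep step n z) B -> forall x,
    hitting_prob step B x = 1%E /\ (mean_hitting_time step B x < +oo)%E.
  move=> zB x.
  have [||U] := @foster_survival R S step step_law B T (m + n).+1 V F b
    (p * prob (nstep step n z) B) T0 V0 b0 _ drift _ x.
  - exact: mulr_gt0.
  - move=> y Fy; apply: le_trans (survival_le_prob _ _ _ _) _ => //.
    rewrite lerD2l lerN2 -addSn.
    by apply: (@prob_nstepD _ _ _ step_law _ _ _ z) => //; [exact: ltW|exact: Fz].
  by move=> leU; apply: (@survival_summable _ _ _ _ _ _ U).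
exists (fun y => accessible step z y); split.
- by exists z; exact: accz.
- move=> x y zx; split=> [zy|]; last exact: accessible_trans.
  exact: accessible_trans zy.
- by move=> x [n zx]; exact: hit zx x.
move=> x; apply: (proj1 (@hit _ 0%N _ x)).
rewrite prob_ret (_ : (_ \in _) = true) ?ltr01//.
by apply: mem_set; exact: accz.
Qed.

(** * One slot of exchanges around a club *)

(* A lower bound on the number of exchanges in which a peer of profile [X] takes
   part in the next [t] slots among infinitely many peers of profile [S]: its
   own downloads and, if it holds exactly one chunk out of [S], one upload per
   slot until it leaves. *)
Definition credit (k t : nat) (S X : profile) : nat :=
  if (#|` S|.+1 < k)%N then ((#|` X `\` S| == 1) * t)%N
  else ((#|` X `\` S| <= 1) * (#|` X `\` S|.+1 * minn t #|` S `\` X|))%N.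

Section Credit.
Variable k : nat.
Implicit Types (S X : profile) (t : nat).

Lemma credit0 S X : credit k 0 S X = 0%N.
Proof. by rewrite /credit min0n !muln0 if_same. Qed.

Lemma credit_self t S : credit k t S S = 0%N.
Proof. by rewrite /credit fsetDv cardfs0 minn0 muln0 if_same. Qed.

Lemma credit_le t S X : (credit k t S X <= 2 * t)%N.
Proof.
rewrite /credit; case: ifP => _; first by case: (_ == _); lia.
by have := geq_minl t #|` S `\` X|; case: #|` X `\` S| => [|[|d]]; lia.
Qed.

(** This makes departures invisible to the credits. A complete profile with at most one chunk out of
    [S] forces |S| = k - 1 and contains [S], so that nothing is left to download. *)
Lemma credit_large t S X : (#|` S| < k)%N -> (k <= #|` X|)%N -> credit k t S X = 0%N.
Proof.
move=> Sk kX; have := cardfsID X S; have := cardfsID S X; rewrite fsetIC => eX eS.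
rewrite /credit; case: ltnP => Sk1; first by case: eqP => //; lia.
case: (leqP #|` X `\` S| 1) => // d1.
by rewrite (_ : #|` S `\` X| = 0%N) ?minn0 ?muln0//; lia.
Qed.

Lemma nsubset_cardfsD S X : ~~ (X `<=` S)%fset = (0 < #|` X `\` S|)%N.
Proof. by rewrite -fsetD_eq0 cardfs_gt0. Qed.

(** Selecting the club brings nothing to such a peer, so the slot lost by its credit has to be paid
    by its upload. If |S| + 1 is at least k its credit vanishes anyway. *)
Lemma credit_superset t S X : (S `<=` X)%fset ->
  (credit k t.+1 S X <= credit k t S X + ~~ (X `<=` S)%fset)%N.
Proof.
rewrite nsubset_cardfsD -fsetD_eq0 => /eqP SX; rewrite /credit SX cardfs0 !minn0 !muln0.
by case: ifP => // _; case: eqP => [->|]; lia.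
Qed.

Lemma credit_download t S X c : c \in (S `\` X)%fset ->
  (credit k t.+1 S X <= (credit k t S (c |` X)).+1 + ~~ (X `<=` S)%fset)%N.
Proof.
rewrite in_fsetD => /andP[cX cS]; rewrite nsubset_cardfsD /credit.
have -> : ((c |` X) `\` S = X `\` S)%fset.
  apply/fsetP => d; rewrite !inE; case: (eqVneq d c) => [->|]//.
  by rewrite cS.
have -> : (S `\` (c |` X) = (S `\` X) `\ c)%fset.
  by apply/fsetP => d; rewrite !inE negb_or andbA.
have := cardfsD1 c (S `\` X)%fset; rewrite in_fsetD cX cS /= => ->.
case: ifP => _; first by case: eqP => [->|]; lia.
move: #|` _ `\ c| #|` X `\` S| => u [|[|d]] /=; rewrite ?mul0n ?mul1n; lia.
Qed.

Let pred_eq (m n : nat) : (m < n)%N -> (n <= m.+1)%N -> n.-1 = m.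
Proof. lia. Qed.

Lemma credit_fresh t S c : (#|` S| < k)%N -> c \notin S ->
  credit k t S [fset c]%fset = if (#|` S|.+1 < k)%N then t else (2 * minn t k.-1)%N.
Proof.
move=> Sk cS; rewrite /credit.
have -> : ([fset c] `\` S = [fset c])%fset by apply/fsetDidPl; rewrite fdisjoint1X.
have -> : (S `\` [fset c] = S)%fset by apply/fsetDidPl; rewrite fdisjointX1.
rewrite cardfs1 /= !mul1n; case: ltnP => // kS.
by rewrite (pred_eq Sk kS).
Qed.

Lemma credit_empty t S : (#|` S| < k)%N ->
  credit k t S fset0 = if (#|` S|.+1 < k)%N then 0%N else minn t k.-1.
Proof.
move=> Sk; rewrite /credit fset0D fsetD0 cardfs0 /= !mul1n mul0n; case: ltnP => // kS.
by rewrite (pred_eq Sk kS).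
Qed.

Lemma imfsetD_inj (f : nat -> nat) S X : injective f ->
  ((f @` X) `\` (f @` S) = f @` (X `\` S))%fset.
Proof.
move=> fi; apply/fsetP => c; rewrite in_fsetD; apply/andP/imfsetP => /=.
  move=> [cS /imfsetP[d /= dX cE]]; exists d => //; rewrite in_fsetD dX andbT.
  by apply: contra cS => dS; rewrite cE; apply/imfsetP; exists d.
move=> [d]; rewrite in_fsetD => /andP[dS dX] ->; split; last by apply/imfsetP; exists d.
by apply: contra dS => /imfsetP[e /= eS /fi ->].
Qed.

Lemma credit_rename (f : nat -> nat) t S X : injective f ->
  credit k t (f @` S)%fset (f @` X)%fset = credit k t S X.
Proof.
move=> fi; have cf (Y : profile) : #|` (f @` Y)%fset| = #|` Y|.
  by rewrite card_imfset.
by rewrite /credit !imfsetD_inj// !cf.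
Qed.

End Credit.

Section Exchange.
Context {R : realType}.
Implicit Types (X Y S : profile) (x y z : config).

Lemma law_independent_map (I T : Type) (s : seq I) (f : I -> fdist R T) :
  (forall i, is_law (f i)) -> forall d, List.In d [seq f i | i <- s] -> is_law d.
Proof. by move=> fl; elim: s => //= i s IH d [<-|]//; exact: IH. Qed.

Lemma law_download X Y : is_law (download X Y : fdist R profile).
Proof. exact: law_uniform. Qed.

Lemma law_contact y i : is_law (contact y i : fdist R profile).
Proof. by apply: law_bind => [|Y]; [exact: law_uniform|exact: law_download]. Qed.

Lemma law_exchange y : is_law (exchange y : fdist R config).
Proof. by apply/law_independent/law_independent_map => i; exact: law_contact. Qed.

Lemma expect_uniform (T : Type) (x0 : T) s (f : T -> R) :
  expect (uniform x0 s) f =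
  if s is [::] then f x0 else (size s)%:R^-1 * \sum_(x <- s) f x.
Proof.
case: s => [|x s]; first exact: expect_ret.
by rewrite /expect /uniform big_map mulr_sumr.
Qed.

Lemma expect_download_le X Y (f : profile -> R) a :
  ((Y `<=` X)%fset -> f X <= a) ->
  (forall c, c \in (Y `\` X)%fset -> f (c |` X)%fset <= a) ->
  expect (download X Y) f <= a.
Proof.
move=> fX fc; rewrite /download.
case E : [seq _ | c <- (Y `\` X)%fset] => [|Z s].
  rewrite expect_ret fX// -fsetD_eq0 -cardfs_eq0.
  by move/(congr1 size): E; rewrite size_map => /eqP.
apply: (@expect_le_cst _ _ (fun Z => f Z <= a)) => //; first exact: law_uniform.
rewrite /surely /uniform all_map; apply/allP => W /=; rewrite -E => /mapP[c cY ->].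
exact: fc.
Qed.

(** Here [g X Y] is the gain when a peer [X] selects a peer [Y]. As [g X X = 0], the selecting peer
    can be added to the sum over its possible partners, which makes the sum run over all of [y]. *)
Lemma expect_contact_le y i (f : profile -> R) a g :
  (i < size y)%N -> (forall X, g X X = 0) ->
  (forall X Y, X \in y -> Y \in y -> expect (download X Y) f <= a X - g X Y) ->
  expect (contact y i) f <= a (nth fset0 y i) -
    (size y).-1%:R^-1 * \sum_(Y <- y) g (nth fset0 y i) Y.
Proof.
move=> iy gXX fa; rewrite /contact; set X := nth _ _ _.
have Xy : X \in y by exact: mem_nth.
set o := take i y ++ drop i.+1 y.
have yE : perm_eq y (X :: o).
  by rewrite -{1}(cat_take_drop i y) (drop_nth fset0)// -cat_rcons -cats1 -catA perm_catCA.
rewrite (perm_big _ yE) (perm_size yE) /= big_cons gXX add0r expect_bind expect_uniform.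
have oy Y : Y \in o -> Y \in y by move=> Yo; rewrite (perm_mem yE) inE Yo orbT.
(* A lonely peer selects itself by the default value of [uniform], with gain [g X X = 0]. *)
case E : o => [|Z s]; first by rewrite big_nil mulr0 -(gXX X); exact: fa.
rewrite -E; have o0 : (size o)%:R != 0 :> R by rewrite E pnatr_eq0.
rewrite -[a X](mulKf o0) -mulrBr ler_wpM2l ?invr_ge0//.
have -> : (size o)%:R * a X = \sum_(Y <- o) a X.
  by rewrite big_const_seq count_predT iter_addr_0 mulr_natl.
rewrite -sumrB big_seq [leRHS]big_seq.
by apply: ler_sum => Y /oy Yy; exact: fa.
Qed.

Lemma expect_exchange_le y (f : profile -> R) a g :
  (forall X, g X X = 0) ->
  (forall X Y, X \in y -> Y \in y -> expect (download X Y) f <= a X - g X Y) ->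
  expect (exchange y) (fun z => \sum_(Z <- z) f Z) <=
  \sum_(X <- y) a X - (size y).-1%:R^-1 * \sum_(X <- y) \sum_(Y <- y) g X Y.
Proof.
move=> gXX fa; rewrite expect_independent_sum; last first.
  by apply: law_independent_map => i; exact: law_contact.
rewrite big_map mulr_sumr -sumrB [leRHS](big_nth fset0) -[size y in leLHS]subn0.
by apply: ler_sum_nat => i /andP[_ iy]; exact: expect_contact_le.
Qed.

Lemma expect_exchange_sqr y (P : pred profile) (a : R) :
  expect (exchange y) (fun z => \sum_(Z <- z) (P Z)%:R) <= a ->
  expect (exchange y) (fun z => (\sum_(Z <- z) (P Z)%:R) ^+ 2) <= a ^+ 2 + a.
Proof.
have dl d : List.In d [seq contact y i | i <- iota 0 (size y)] -> @is_law R _ d.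
  by apply: law_independent_map => i; exact: law_contact.
by move=> le_a; apply: expect_independent_sqr => //; rewrite -expect_independent_sum.
Qed.

Lemma sum_count (T : Type) (P : pred T) s : \sum_(x <- s) (P x)%:R = (count P s)%:R :> R.
Proof. by elim: s => [|x s IH]; rewrite ?big_nil// big_cons IH natrD. Qed.

End Exchange.

(** * Load, credits and excess during one exchange *)

Section Load.
Context {R : realType}.
Variable k : nat.
Implicit Types (X Y S : profile) (x y z : config).

Definition load x : R := \sum_(X <- x) (k - #|` X|)%:R.

Definition active x := all (fun X : profile => #|` X| < k)%N x.

Definition credits t S x : R := \sum_(X <- x) (credit k t S X)%:R.

(* With [M] the initial size of the club of the peers of profile [S]: the peers
   outside of the club plus the losses of the club. *)
Definition excess M S x : nat := (count (predC1 S) x + (M - count_mem S x))%N.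

Lemma active_leave x : active (leave k x).
Proof. exact: filter_all. Qed.

Lemma leave_active x : active x -> leave k x = x.
Proof. by move/all_filterP. Qed.

Lemma active_mem x X : active x -> X \in x -> (#|` X| < k)%N.
Proof. by move=> /allP xk /xk. Qed.

Lemma sum_leave (f : profile -> R) x :
  (forall X, (k <= #|` X|)%N -> f X = 0) ->
  \sum_(X <- leave k x) f X = \sum_(X <- x) f X.
Proof.
move=> f0; rewrite /leave big_filter big_mkcond; apply: eq_bigr => X _.
by case: ltnP => // /f0.
Qed.

Lemma load_leave x : load (leave k x) = load x.
Proof. by apply: sum_leave => X kX; rewrite (eqP (_ : (k - _)%N == 0%N))// subn_eq0. Qed.

Lemma load_cat x y : load (x ++ y) = load x + load y.
Proof. exact: big_cat. Qed.

Lemma load_ge0 x : 0 <= load x.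
Proof. exact: sumr_ge0. Qed.

Lemma credits_leave t S x : (#|` S| < k)%N -> credits t S (leave k x) = credits t S x.
Proof. by move=> Sk; apply: sum_leave => X kX; rewrite credit_large. Qed.

Lemma credits_cat t S x y : credits t S (x ++ y) = credits t S x + credits t S y.
Proof. exact: big_cat. Qed.

Lemma credits_ge0 t S x : 0 <= credits t S x.
Proof. exact: sumr_ge0. Qed.

Lemma credits_le t S x : credits t S x <= 2 * t%:R * (count (predC1 S) x)%:R.
Proof.
rewrite -sum_count mulr_sumr; apply: ler_sum => X _ /=.
case: eqP => [->|_]; first by rewrite credit_self mulr0.
by rewrite mulr1 -natrM ler_nat credit_le.
Qed.

Lemma missing_add (X : profile) c : (#|` X| < k)%N -> c \notin X ->
  (k - #|` c |` X|)%:R = (k - #|` X|)%:R - 1 :> R.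
Proof. by move=> Xk cX; rewrite cardfsU1 cX add1n -(subnSK Xk) -natr1 addrK. Qed.

Lemma missing_addU (X : profile) c :
  (k - #|` c |` X|)%:R <= (k - #|` X|)%:R :> R.
Proof. by rewrite ler_nat leq_sub2l// fsubset_leq_card// fsubsetU1. Qed.

Lemma exchange_load y : active y ->
  expect (exchange y) load <=
  load y - (size y).-1%:R^-1 * \sum_(X <- y) \sum_(Y <- y) (~~ (Y `<=` X)%fset)%:R.
Proof.
move=> yk; apply: (@expect_exchange_le _ y _ _ (fun X Y => (~~ (Y `<=` X)%fset)%:R)).
  by move=> X; rewrite fsubset_refl.
move=> X Y Xy Yy; apply: expect_download_le => [->|c]; first by rewrite subr0.
rewrite in_fsetD => /andP[cX cY]; rewrite missing_add//; last exact: active_mem Xy.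
by rewrite lerD2l lerN2; case: (_ `<=` _)%fset; rewrite ?ler01.
Qed.

(** An upload is earned when a club member selects an outsider, whereas the credit of the outsider
    is drawn on when it selects the club. The gain [g] books each where it occurs: [u] is added in
    the first kind of pair and subtracted in the second. Each outsider belongs to [count_mem S y]
    pairs of either kind, so the terms [u] cancel in the sum. *)
Lemma exchange_credit t S y : (#|` S| < k)%N -> active y ->
  expect (exchange y) (fun z => load z - credits t S z) <=
  load y - (size y).-1%:R^-1 * ((count_mem S y)%:R * credits t.+1 S y).
Proof.
move=> Sk yk.
pose u X : R := (~~ (X `<=` S)%fset)%:R.
pose g X Y : R := (X == S)%:R * u Y + (Y == S)%:R * ((credit k t.+1 S X)%:R - u X).
have uS : u S = 0 by rewrite /u fsubset_refl.
have -> : (count_mem S y)%:R * credits t.+1 S y = \sum_(X <- y) \sum_(Y <- y) g X Y.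
  rewrite /g; under eq_bigr do rewrite big_split/= -mulr_sumr -mulr_suml sum_count.
  rewrite big_split /= -mulr_suml -mulr_sumr sum_count -mulrDr; congr (_ * _).
  by rewrite sumrB -sum_count addrCA subrr addr0.
rewrite (_ : (fun z => _) = fun z => \sum_(Z <- z) ((k - #|` Z|)%:R - (credit k t S Z)%:R)); last first.
  by apply/funext => z; rewrite sumrB.
apply: expect_exchange_le => [X|X Y Xy Yy].
  rewrite /g; case: eqP => [->|_]; last by rewrite !mul0r addr0.
  by rewrite credit_self uS subrr !mulr0 addr0.
have Xk := active_mem yk Xy.
have cr0 Z : 0 <= (credit k t S Z)%:R :> R by [].
have le_cr n m b : (n <= m + nat_of_bool b)%N -> n%:R <= m%:R + b%:R :> R.
  by rewrite -natrD ler_nat.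
rewrite /g; case: (eqVneq X S) => [XS|XS].
  rewrite XS uS credit_self subrr mulr0 mul1r addr0.
  apply: expect_download_le => [YS|c].
    by rewrite credit_self /u YS.
  rewrite in_fsetD => /andP[cS cY]; rewrite missing_add// /u.
  by have := cr0 (c |` S)%fset; case: (_ `<=` _)%fset => /=; lra.
rewrite mul0r add0r; case: (eqVneq Y S) => [->|YS].
  rewrite mul1r; apply: expect_download_le => [SX|c cSX].
    have := le_cr _ _ _ (credit_superset k t SX); rewrite -/(u X); lra.
  have := le_cr _ _ _ (credit_download k t cSX); rewrite -/(u X) -natr1.
  move: cSX; rewrite in_fsetD => /andP[cX _]; rewrite missing_add//; lra.
rewrite mul0r subr0; apply: expect_download_le => [_|c _].
  by have := cr0 X; lra.
by have := cr0 (c |` X)%fset; have := missing_addU X c; lra.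
Qed.

(** A member leaves the club only by selecting an outsider, and an outsider is selected by at most
    one member in the mean. These losses enter [expect_exchange_le] as a negative gain. *)
Lemma exchange_outsiders S y :
  expect (exchange y) (fun z => \sum_(Z <- z) (predC1 S Z)%:R) <=
  2 * (count (predC1 S) y)%:R :> R.
Proof.
pose g X Y : R := - ((X == S)%:R * (predC1 S Y)%:R).
apply: (@le_trans _ _ (\sum_(X <- y) (predC1 S X)%:R -
    (size y).-1%:R^-1 * \sum_(X <- y) \sum_(Y <- y) g X Y)).
  apply: expect_exchange_le => [X|X Y Xy Yy].
    by rewrite /g /=; case: eqP; rewrite ?mulr0 ?mul0r oppr0.
  rewrite /g opprK; apply: expect_download_le => [YX|c]; rewrite /=.
    by rewrite lerDl mulr_ge0.
  rewrite in_fsetD => /andP[cX cY].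
  case: (eqVneq X S) => [<-|_] /=; last first.
    by rewrite mul0r addr0; case: eqP.
  rewrite mul1r add0r; case: (eqVneq Y X) => [YX|_]; last by case: eqP.
  by rewrite YX (negPf cX) in cY.
have -> : \sum_(X <- y) \sum_(Y <- y) g X Y =
    - ((count_mem S y)%:R * (count (predC1 S) y)%:R).
  rewrite -!sum_count mulr_suml -sumrN; apply: eq_bigr => X _.
  by rewrite mulr_sumr -sumrN.
rewrite sum_count.
have := count_predC (pred1 S) y; set n := count (pred1 S) y.
rewrite (_ : count (predC (pred1 S)) y = count (predC1 S) y)//.
set m := count _ _ => nm.
rewrite mulrN opprK [leRHS]mulr_natl mulr2n lerD2l mulrA.
case: (posnP m) => [->|m0]; first by rewrite mulr0.
rewrite ler_piMl// mulrC; case: (posnP n) => [->|n0]; first by rewrite mul0r.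
rewrite ler_pdivrMr ?mul1r ?ltr0n ?ler_nat; move: nm m0 n0; move: n m (size y); lia.
Qed.

(** With B the new number of outsiders, m the old one and e the old excess, the new excess is at
    most 2B + e because the exchange itself preserves the number of peers. The constant is 8 * 6 +
    2: the square of 2B + (e + 1) is at most 8 B^2 + 2 (e + 1)^2, and the mean of B^2 is at most
    (2m)^2 + 2m, hence at most 6 e^2. *)
Lemma exchange_excess M S y : (#|` S| < k)%N ->
  expect (exchange y) (fun z => ((excess M S (leave k z)).+1%:R ^+ 2)) <=
  50 * (excess M S y).+1%:R ^+ 2 :> R.
Proof.
move=> Sk; have law_y := @law_exchange R y.
set e := excess M S y; set m := count (predC1 S) y.
pose B (z : config) : R := \sum_(Z <- z) (predC1 S Z)%:R.
have sz : surely (fun z : config => size z == size y) (@exchange R y).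
  have := surely_size_independent [seq @contact R y i | i <- iota 0 (size y)].
  by rewrite size_map size_iota.
have me : m%:R <= e%:R :> R by rewrite ler_nat /e /excess leq_addr.
apply: (@le_trans _ _ (expect (exchange y) (fun z => 8 * B z ^+ 2 + 2 * e.+1%:R ^+ 2))).
  apply: le_expect_on sz _; first by case: law_y.
  move=> z /eqP szy.
  have : ((excess M S (leave k z)).+1 <= 2 * count (predC1 S) z + e.+1)%N.
    rewrite /e /excess.
    have -> : count_mem S (leave k z) = count_mem S z.
      rewrite /leave count_filter; apply: eq_count => X /=.
      by case: eqP => // ->; rewrite Sk.
    have : (count (predC1 S) (leave k z) <= count (predC1 S) z)%N.
      by rewrite /leave count_filter; apply: sub_count => X /= /andP[].
    have := count_predC (pred1 S) z; have := count_predC (pred1 S) y; rewrite szy.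
    rewrite -/(count (predC1 S) z) -/(count (predC1 S) y).
    move: (count _ y) (count _ z) (count _ y) (count _ z) (count _ (leave _ _)) (size y).
    by move=> *; lia.
  rewrite -(ler_nat R) natrD natrM -sum_count -/(B z).
  have : 0 <= B z by exact: sumr_ge0.
  move: (B z) (excess _ _ _) => b q b0 q_le.
  have q0 : (0 : R) <= q.+1%:R by [].
  have e0 : (0 : R) <= e.+1%:R by [].
  move: q_le q0 e0; move: q.+1%:R e.+1%:R => u v *.
  have : u ^+ 2 <= (2 * b + v) ^+ 2 by rewrite lerXn2r// nnegrE addr_ge0// mulr_ge0.
  have : 0 <= (2 * b - v) ^+ 2 by exact: sqr_ge0.
  by rewrite !expr2; lra.
rewrite expectD expectZ expect_cst//.
have := expect_exchange_sqr (exchange_outsiders S y); rewrite -/m.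
have : (m ^ 2 >= m)%N by case: (m) => // p; nia.
rewrite -(ler_nat R) natrX -[e.+1%:R]natr1.
rewrite -/(B _) => aa; move: (expect _ _) me => u.
have : (0 : R) <= m%:R by [].
move: aa; move: (m%:R) (e%:R) => a b aa a0 ab.
have : a ^+ 2 <= b ^+ 2 by rewrite lerXn2r// nnegrE (le_trans a0).
rewrite !expr2 in aa *; lra.
Qed.

(** The term in [K] stands for the errors of the [t] later slots. The present error comes from
    outsiders meeting the club at the rate [r] instead of 1; the shortage [c * (1 - r)] is quadratic
    in the excess over [M]. *)
Lemma exchange_drift t S M K y : (#|` S| < k)%N -> active y -> (0 < M)%N -> 0 <= K ->
  expect (exchange y) (fun z => load (leave k z) - credits t S (leave k z) +
    K * (excess M S (leave k z)).+1%:R ^+ 2 / M%:R) <=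
  load y - credits t.+1 S y +
  (4 * t.+1%:R + 50 * K) * (excess M S y).+1%:R ^+ 2 / M%:R.
Proof.
move=> Sk yk M0 K0.
have M0' : (0 : R) < M%:R by rewrite ltr0n.
under eq_expect do rewrite load_leave credits_leave// mulrAC.
rewrite expectD expectZ.
have qe := exchange_excess M y Sk; set q := expect _ (fun z => _ ^+ 2) in qe *.
have pe := exchange_credit t Sk yk; set p := expect _ _ in pe *.
have KM : 0 <= K / M%:R by rewrite divr_ge0.
have := ler_wpM2l KM qe.
set E := excess M S y in qe *; set n := count_mem S y in pe.
set m := count (predC1 S) y.
set r : R := (size y).-1%:R^-1 * n%:R.
set c := credits t.+1 S y in pe *.
have c0 : 0 <= c by exact: credits_ge0.
have cm : c <= 2 * t.+1%:R * m%:R by exact: credits_le.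
suff H : c * (1 - r) <= 4 * t.+1%:R * E.+1%:R ^+ 2 / M%:R.
  move: pe H; rewrite mulrA -/r; set l := load y.
  move: (M%:R^-1) (E.+1%:R ^+ 2) => i e2; lra.
rewrite ler_pdivlMr//.
have nm : (n + m = size y)%N by exact: count_predC.
have r0 : 0 <= r by rewrite mulr_ge0.
have mE : (m <= E.+1)%N by rewrite ltnW// ltnS leq_addr.
have mE' : m%:R <= E.+1%:R :> R by rewrite ler_nat.
have t0 : (0 : R) < t.+1%:R by [].
have m0' : (0 : R) <= m%:R by [].
(* If the club keeps at least half of [M], then 1 - r is at most 2m / M while c is at most 2 (t + 1)
   m. Otherwise [M] is at most twice the excess plus one, and the crude bound 1 - r <= 1 is
   enough. *)
case: (leqP M (2 * n)) => [Mn|nM].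
  case: (posnP m) => [m0|m0].
    have -> : c = 0 by apply/eqP; rewrite eq_le c0 andbT (le_trans cm)// m0 mulr0.
    by rewrite !mul0r mulr_ge0// ?sqr_ge0// mulr_ge0.
  have [Nn N0 mN] : [/\ n <= (size y).-1, 0 < (size y).-1 & (size y).-1 - n = m.-1]%N.
    clear -nm m0 Mn M0; move: nm m0 Mn M0; move: n m (size y) => *; split; lia.
  have N0' : (0 : R) < (size y).-1%:R by rewrite ltr0n.
  have rE : 1 - r = (m.-1)%:R / (size y).-1%:R.
    rewrite /r mulrC -[X in X - _](divff (lt0r_neq0 N0')) -mulrBl.
    by rewrite -natrB// mN.
  have Mr : (1 - r) * M%:R <= 2 * m%:R.
    rewrite rE mulrAC ler_pdivrMr// -!natrM ler_nat.
    clear -nm Mn Nn N0 m0; move: nm Mn Nn N0 m0; move: (size y) n m; nia.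
  rewrite -(mulrA c); apply: (@le_trans _ _ (c * (2 * m%:R))); first by rewrite ler_wpM2l.
  apply: (@le_trans _ _ (2 * t.+1%:R * m%:R * (2 * m%:R))).
    by rewrite ler_wpM2r// mulr_ge0.
  have : m%:R ^+ 2 <= E.+1%:R ^+ 2 :> R by rewrite lerXn2r// nnegrE.
  by rewrite !expr2; nra.
have ME : (M <= 2 * E.+1)%N.
  by rewrite /E /excess -/m -/n; clear -nM; move: nM; move: n m => *; lia.
have : M%:R <= 2 * E.+1%:R :> R by rewrite -natrM ler_nat.
move: mE' (ltW M0') t0 m0' cm; move: (M%:R) (E.+1%:R) (t.+1%:R) (m%:R) => M' e t' m' *.
apply: (@le_trans _ _ (2 * t' * m' * M')).
  rewrite ler_wpM2r//; apply: le_trans _ (_ : c <= _) => //.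
  by rewrite ler_piMr// lerBlDr lerDl.
have : m' * M' <= e * (2 * e) by rewrite ler_pM.
rewrite expr2; nra.
Qed.
End Load.

(** * A whole slot: arrivals, exchange and departures *)

Section Slot.
Context {R : realType}.
Variables (k : nat) (lambda : R) (A : nat) (mu : nat -> R).
Hypothesis lambda_gt1 : 1 < lambda.
Hypothesis mu_law : arrival_law lambda A mu.
Implicit Types (X Y S : profile) (x y z : config).

Let lambda_gt0 : 0 < lambda. Proof. exact: lt_trans lambda_gt1. Qed.

Let expect_arrivals f : expect (arrivals A mu) f = \sum_(n < A) mu n * f n.
Proof. by rewrite /expect big_map -[A in LHS]subn0 -[iota _ _]/(index_iota 0 A) big_mkord. Qed.

Lemma law_arrivals : is_law (arrivals A mu).
Proof.
case: mu_law => mu0 _ mu1 _; split; last first.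
  by rewrite expect_arrivals; under eq_bigr do rewrite mulr1.
by rewrite /nonneg all_map; apply/allP => n _ /=.
Qed.

Lemma expect_arrivals_id : expect (arrivals A mu) (fun n => n%:R) = lambda.
Proof.
by case: mu_law => _ _ _ <-; rewrite expect_arrivals; apply: eq_bigr => n _; rewrite mulrC.
Qed.

Lemma surely_arrivals : surely (fun n => n < A)%N (arrivals A mu).
Proof. by rewrite /surely all_map; apply/allP => n /=; rewrite mem_iota. Qed.

Lemma law_newcomer c : is_law (newcomer lambda c).
Proof.
split; first by rewrite /nonneg /= invr_ge0 ltW//= mulr_ge0// ?invr_ge0 ?subr_ge0 ltW.
rewrite /expect /newcomer !big_cons big_nil /= !mulr1 addr0.
by field; rewrite gt_eqF.
Qed.

Lemma expect_newcomer c f : expect (newcomer lambda c) f =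
  (f [fset c]%fset + (lambda - 1) * f fset0) / lambda.
Proof.
by rewrite /expect /newcomer !big_cons big_nil /=; field; rewrite gt_eqF.
Qed.

Lemma law_newcomers x n : is_law (newcomers lambda x n).
Proof. by apply/law_independent/law_independent_map => i; exact: law_newcomer. Qed.

Lemma law_slot x : is_law (slot k lambda A mu x).
Proof.
apply: law_bind law_arrivals _ => n; apply: law_bind (law_newcomers x n) _ => s.
by apply: law_bind => [|z]; [exact: law_exchange|exact: law_ret].
Qed.

(** A bound additive over the newcomers involves the arrival law only through its mean [lambda], so
    each newcomer may contribute [b / lambda]. *)
Lemma expect_slot_le x (f : config -> R) w a b :
  (forall s, (size s <= A)%N ->
    expect (exchange (leave k (x ++ s))) (fun z => f (leave k z)) <=
    a + \sum_(Z <- s) w Z) ->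
  (forall i, expect (newcomer lambda (fresh x + i)%N) w <= b / lambda) ->
  expect (slot k lambda A mu x) f <= a + b.
Proof.
move=> fa wb.
have [an _] := law_arrivals.
apply: (@le_trans _ _ (expect (arrivals A mu) (fun n => a + (b / lambda) * n%:R))); last first.
  by rewrite expectD expectZ expect_arrivals_id expect_cst ?divfK ?gt_eqF//; exact: law_arrivals.
rewrite /slot expect_bind; apply: le_expect_on an surely_arrivals _ => n nA.
rewrite expect_bind.
apply: (@le_trans _ _ (expect (newcomers lambda x n) (fun s => a + \sum_(Z <- s) w Z))).
  have sz := surely_size_independent [seq newcomer lambda (fresh x + i)%N | i <- iota 0 n].
  apply: le_expect_on sz _ => [|s]; first by case: (law_newcomers x n).
  rewrite size_map size_iota => /eqP sn; rewrite expect_bind.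
  under eq_expect do rewrite expect_ret.
  by apply: fa; rewrite sn ltnW.
rewrite expectD expect_cst; last exact: law_newcomers.
rewrite lerD2l expect_independent_sum; last first.
  by apply: law_independent_map => i; exact: law_newcomer.
rewrite big_map; apply: (@le_trans _ _ (\sum_(i <- iota 0 n) b / lambda)).
  by apply: ler_sum => i _.
by rewrite big_const_seq count_predT size_iota iter_addr_0 mulr_natr.
Qed.

(** The newcomers of a slot lack [lambda * k] chunks in the mean, minus the one chunk that the
    server pushes. *)
Lemma slot_load_le x : (0 < k)%N ->
  expect (slot k lambda A mu x) (load k) <= load k x + (lambda * k%:R - 1).
Proof.
move=> k0; apply: (@expect_slot_le _ _ (fun X => (k - #|` X|)%:R)) => [s _|i].
  under eq_expect do rewrite load_leave.
  apply: le_trans (exchange_load (active_leave _ _)) _.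
  rewrite load_leave load_cat lerBlDr lerDl mulr_ge0//.
  by apply: sumr_ge0 => X _; apply: sumr_ge0.
rewrite expect_newcomer cardfs0 cardfs1 subn0 natrB// ler_pM2r ?invr_gt0//; lra.
Qed.

Lemma slot_load_useful x : (0 < k)%N -> active k x -> (1 < size x)%N ->
  expect (slot k lambda A mu x) (load k) <= load k x + (lambda * k%:R - 1) -
  (size x + A)%:R^-1 * \sum_(X <- x) \sum_(Y <- x) (~~ (Y `<=` X)%fset)%:R.
Proof.
move=> k0 xk x1; set u := \sum_(X <- x) _; rewrite addrAC.
apply: (@expect_slot_le _ _ (fun X => (k - #|` X|)%:R)) => [s sA|i]; last first.
  rewrite expect_newcomer cardfs0 cardfs1 subn0 natrB// ler_pM2r ?invr_gt0//; lra.
under eq_expect do rewrite load_leave.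
apply: le_trans (exchange_load (active_leave _ _)) _.
rewrite load_leave load_cat addrAC lerD2r lerD2l lerN2.
have -> : leave k (x ++ s) = x ++ leave k s by rewrite /leave filter_cat -!/(leave k _) (leave_active xk).
have u0 : 0 <= u by apply: sumr_ge0 => X _; exact: sumr_ge0.
have sz : (0 < (size (x ++ leave k s)).-1)%N by rewrite size_cat; lia.
apply: ler_pM => //.
  rewrite lef_pV2 ?posrE ?ltr0n//; last by lia.
  rewrite ler_nat size_cat.
  have : (size (leave k s) <= size s)%N by rewrite size_filter count_size.
  move: (size (leave k s)) (size s) sA => ? ? ? ?; lia.
rewrite big_cat /= -[u]addr0 lerD//; last first.
  by apply: sumr_ge0 => X _; exact: sumr_ge0.
by apply: ler_sum => X _; rewrite big_cat /= lerDl; apply: sumr_ge0.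
Qed.

Lemma mem_fresh x X c : X \in x -> c \in X -> (c < fresh x)%N.
Proof.
move=> Xx cX; rewrite ltnS.
by apply: leq_trans (leq_bigmax_seq _ cX isT) (leq_bigmax_seq _ Xx isT).
Qed.

(* The expected credits of the newcomers of a slot. *)
Definition income t S : R :=
  if (#|` S|.+1 < k)%N then t%:R else (lambda + 1) * (minn t k.-1)%:R.

Lemma income_le t S : income t S <= (lambda + 1) * t%:R.
Proof.
rewrite /income; case: ifP => _; last by rewrite ler_wpM2l ?ler_nat ?geq_minl ?addr_ge0// ltW.
by rewrite ler_peMl// lerDr ltW.
Qed.

Lemma newcomer_credit t S c : (#|` S| < k)%N ->
  expect (newcomer lambda c) (fun X => (k - #|` X|)%:R - (credit k t S X)%:R) <=
  (lambda * k%:R - 1 - (if c \in S then 0 else income t S)) / lambda.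
Proof.
move=> Sk; have k0 : (0 < k)%N by exact: leq_ltn_trans Sk.
rewrite expect_newcomer ler_pM2r ?invr_gt0//.
rewrite cardfs0 cardfs1 subn0 natrB//.
have l1 : 0 <= lambda - 1 by rewrite subr_ge0 ltW.
case: (boolP (c \in S)) => cS.
  have : 0 <= (credit k t S [fset c]%fset)%:R :> R by [].
  have : 0 <= (lambda - 1) * (credit k t S fset0)%:R by rewrite mulr_ge0.
  lra.
rewrite credit_fresh// credit_empty// /income; case: ifP => _; first lra.
rewrite natrM; lra.
Qed.

(** At most [A] arrivals multiply the excess plus one by at most [A.+1], whence the square of
    [A.+1]. The summand [(lambda + 1) * t.+1%:R] pays for the income lost when the label of a pushed
    chunk happens to lie in [S]. *)
Lemma slot_drift t S M K x : (#|` S| < k)%N -> (0 < M)%N -> 0 <= K ->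
  expect (slot k lambda A mu x) (fun y => load k y - credits k t S y +
    K * (excess M S y).+1%:R ^+ 2 / M%:R) <=
  load k x - credits k t.+1 S x + (lambda * k%:R - 1) - income t.+1 S +
  ((4 * t.+1%:R + 50 * K) * A.+1%:R ^+ 2 + (lambda + 1) * t.+1%:R) *
    (excess M S x).+1%:R ^+ 2 / M%:R.
Proof.
move=> Sk M0 K0; set E := (excess M S x).+1%:R.
have M0' : (0 : R) < M%:R by rewrite ltr0n.
have E1 : 1 <= E by rewrite ler1n.
have l1 : 0 <= (lambda + 1) * t.+1%:R by rewrite mulr_ge0// addr_ge0// ltW.
pose w X : R := (k - #|` X|)%:R - (credit k t.+1 S X)%:R.
pose i := (lambda + 1) * t.+1%:R * E ^+ 2 / M%:R.
have i0 : 0 <= i by rewrite /i divr_ge0// mulr_ge0// sqr_ge0.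
have -> : load k x - credits k t.+1 S x + (lambda * k%:R - 1) - income t.+1 S +
  ((4 * t.+1%:R + 50 * K) * A.+1%:R ^+ 2 + (lambda + 1) * t.+1%:R) * E ^+ 2 / M%:R =
  (load k x - credits k t.+1 S x +
    (4 * t.+1%:R + 50 * K) * (A.+1%:R * E) ^+ 2 / M%:R) +
  (lambda * k%:R - 1 - income t.+1 S + i).
  rewrite /i exprMn; ring.
apply: (@expect_slot_le _ _ w) => [s sA|j].
  apply: le_trans (exchange_drift _ Sk (active_leave _ _) M0 K0) _.
  rewrite load_leave load_cat credits_leave// credits_cat.
  have -> : \sum_(Z <- s) w Z = load k s - credits k t.+1 S s by rewrite sumrB.
  have : (4 * t.+1%:R + 50 * K) * (excess M S (leave k (x ++ s))).+1%:R ^+ 2 / M%:R <=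
         (4 * t.+1%:R + 50 * K) * (A.+1%:R * E) ^+ 2 / M%:R; last lra.
  rewrite ler_pM2r ?invr_gt0// ler_wpM2l//; first by rewrite addr_ge0// mulr_ge0.
  rewrite lerXn2r ?nnegrE// ?mulr_ge0// -natrM ler_nat.
  have : (excess M S (leave k (x ++ s)) <= excess M S x + size s)%N.
    rewrite /excess /leave filter_cat !count_cat !count_filter.
    have -> : count (predI (pred1 S) (fun X => #|` X| < k)%N) x = count_mem S x.
      by apply: eq_count => X /=; case: eqP => // ->; rewrite Sk.
    have : (count (predI (predC1 S) (fun X => #|` X| < k)%N) x <= count (predC1 S) x)%N.
      by apply: sub_count => X /= /andP[].
    have : (count (predI (predC1 S) (fun X => #|` X| < k)%N) s <= size s)%N.
      exact: count_size.
    move: (count _ _) (count _ _) (count _ _) (count _ x) (count _ _) => *; lia.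
  move: (excess _ _ _) (excess _ _ _) (size s) sA => *; nia.
apply: le_trans (newcomer_credit _ _ Sk) _; rewrite ler_pM2r ?invr_gt0//.
(* If a fresh label lies in [S], no present peer has profile [S]: the excess is then at least [M],
   and the error term exceeds the income. *)
case: (boolP (_ \in S)) => cS; last lra.
suff : income t.+1 S <= i by lra.
apply: le_trans (income_le _ _) _; rewrite /i -mulrA ler_peMr//.
have Sx : S \notin x.
  by apply: contraTN cS => Sx; apply/negP => /(mem_fresh Sx); rewrite ltnNge leq_addr.
rewrite ler_pdivlMr// mul1r (@le_trans _ _ E)//; last by rewrite ler_eXnr.
by rewrite ler_nat /excess (count_memPn Sx) subn0 ltnW// ltnS leq_addl.
Qed.

End Slot.

(** * Drift of the work over several slots *)

Lemma archi_nat (R : realType) (x : R) : exists n : nat, x <= n%:R.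
Proof.
exists (Num.bound `|x|); apply: le_trans (ler_norm x) (ltW (archi_boundP _)).
exact: normr_ge0.
Qed.

(** * Invariance under renaming, and existence of a club *)

Section Renaming.
Context {R : realType}.
Variable k : nat.
Implicit Types (X Y S : profile) (x y z : config).

Lemma imfset_inj (f : nat -> nat) X Y : injective f ->
  ((f @` X)%fset == (f @` Y)%fset) = (X == Y).
Proof.
move=> fi; apply/eqP/eqP => [E|->//]; apply/fsetP => c.
by rewrite -[LHS](mem_imfset imfset_key _ fi) E mem_imfset.
Qed.

Lemma rename_cardfs (f : nat -> nat) X : injective f -> #|` (f @` X)%fset| = #|` X|.
Proof. by move=> fi; rewrite card_imfset. Qed.

Lemma same_stateP x y : same_state x y ->
  exists2 f : nat -> nat, injective f & perm_eq (rename f x) y.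
Proof. by move=> /asboolP[f fb xy]; exists f => //; exact: bij_inj. Qed.

Lemma same_state_load x y : same_state x y -> load k x = load k y :> R.
Proof.
move=> /same_stateP[f fi xy]; rewrite /load -(perm_big _ xy) big_map.
by apply: eq_bigr => X _; rewrite rename_cardfs.
Qed.

Lemma same_state_active x y : same_state x y -> active k x = active k y.
Proof.
move=> /same_stateP[f fi xy]; rewrite /active -(perm_all _ xy) all_map.
by apply: eq_all => X /=; rewrite rename_cardfs.
Qed.

Lemma same_state_club x y S : same_state x y -> exists S',
  [/\ #|` S'| = #|` S|,
      forall t, credits k t S' y = credits k t S x :> R
    & forall M, excess M S' y = excess M S x].
Proof.
move=> /same_stateP[f fi xy]; exists (f @` S)%fset; split.
- exact: rename_cardfs.
- move=> t; rewrite /credits -(perm_big _ xy) big_map.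
  by apply: eq_bigr => X _; rewrite credit_rename.
move=> M; rewrite /excess -!(permP xy) !count_map.
by congr (_ + (_ - _))%N; apply: eq_count => X /=; rewrite imfset_inj.
Qed.

Lemma same_state_repr x : same_state x (repr (\pi_state x)%qT).
Proof. by rewrite same_state_sym; apply/eqmodP; rewrite reprK. Qed.

(* If most ordered pairs of peers are useless then most peers are identical:
   of two different profiles, one is not included in the other. *)
Lemma few_useful_club x (c : nat) : x != [::] ->
  \sum_(X <- x) \sum_(Y <- x) (~~ (Y `<=` X)%fset)%:R <= (c * size x)%:R :> R ->
  exists S, (count (predC1 S) x <= 2 * c)%N.
Proof.
move=> x0 ux.
have [/hasP[S _ Sc]|/hasPn noS] := boolP (has (fun S => count (predC1 S) x <= 2 * c)%N x).
  by exists S.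
have : (\sum_(X <- x) (2 * c).+1%:R : R) <= \sum_(X <- x) (count (predC1 X) x)%:R.
  rewrite !big_seq; apply: ler_sum => X /noS; rewrite -ltnNge => ?.
  by rewrite ler_nat.
rewrite big_const_seq count_predT iter_addr_0 -mulrnA.
have : \sum_(X <- x) (count (predC1 X) x)%:R <= \sum_(X <- x) \sum_(Y <- x)
    ((~~ (Y `<=` X)%fset)%:R + (~~ (X `<=` Y)%fset)%:R) :> R.
  apply: ler_sum => X _; rewrite -sum_count; apply: ler_sum => Y _ /=.
  rewrite -natrD ler_nat eqEfsubset negb_and.
  by case: (Y `<=` X)%fset; case: (X `<=` Y)%fset.
under [X in _ <= X]eq_bigr do rewrite big_split /=.
rewrite big_split /= [X in _ <= _ + X]exchange_big /=.
have : (0 < size x)%N by case: (x) x0.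
move: ux; set U := \sum_(_ <- _) _; set V := \sum_(_ <- _) _ => Uc x1 VU le_V.
have : ((2 * c).+1 * size x)%:R <= (2 * (c * size x))%:R :> R.
  by rewrite natrM [in leRHS]natrM; lra.
by rewrite ler_nat; nia.
Qed.

End Renaming.

Section Drift.
Context {R : realType}.
Variables (k : nat) (lambda : R) (A : nat) (mu : nat -> R).
Hypothesis lambda_gt1 : 1 < lambda.
Hypothesis mu_law : arrival_law lambda A mu.
Hypothesis lambda_lt_k : lambda < k%:R.

Let k_gt0 : (0 < k)%N.
Proof. by rewrite -(ltr_nat R) (lt_trans _ lambda_lt_k)// (lt_trans _ lambda_gt1). Qed.

Local Notation chain := (p2p_chain k lambda A mu).
Local Notation work s := (load k (repr (s : state)) : R).

Lemma law_chain s : is_law (chain s).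
Proof. by apply: law_bind => [|y]; [exact: law_slot|exact: law_ret]. Qed.

Lemma expect_chain s f :
  expect (chain s) f = expect (slot k lambda A mu (repr s)) (fun y => f (\pi_state y)%qT).
Proof. by rewrite expect_bind; apply: eq_expect => y; rewrite expect_ret. Qed.

Lemma work_pi y : work (\pi_state y)%qT = load k y.
Proof. by rewrite -(same_state_load k (same_state_repr y)). Qed.

Lemma expect_nstepS t s f : expect (nstep chain t.+1 s) f =
  expect (slot k lambda A mu (repr s))
    (fun y => expect (nstep chain t (\pi_state y)%qT) f).
Proof.
rewrite expect_nstep /= /transition expect_chain; apply: eq_expect => y.
by rewrite expect_nstep.
Qed.

Lemma work_le t s : expect (nstep chain t s) (fun s => work s) <=
  work s + t%:R * (lambda * k%:R - 1).
Proof.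
elim: t s => [|t IH] s; first by rewrite expect_ret mul0r addr0.
rewrite expect_nstepS.
apply: (@le_trans _ _ (expect (slot k lambda A mu (repr s))
    (fun y => load k y + t%:R * (lambda * k%:R - 1)))).
  apply: le_expect => [|y]; first by case: (law_slot k lambda_gt1 mu_law (repr s)).
  by rewrite -work_pi; exact: IH.
rewrite expectD expect_cst; last exact: law_slot.
have := slot_load_le lambda_gt1 mu_law (repr s) k_gt0; rewrite -natr1; lra.
Qed.

Lemma work_le_useful t s : active k (repr s) -> (1 < size (repr s))%N ->
  expect (nstep chain t.+1 s) (fun s => work s) <=
  work s + t.+1%:R * (lambda * k%:R - 1) - (size (repr s) + A)%:R^-1 *
    \sum_(X <- repr s) \sum_(Y <- repr s) (~~ (Y `<=` X)%fset)%:R.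
Proof.
move=> sk s1; rewrite expect_nstepS.
apply: (@le_trans _ _ (expect (slot k lambda A mu (repr s))
    (fun y => load k y + t%:R * (lambda * k%:R - 1)))).
  apply: le_expect => [|y]; first by case: (law_slot k lambda_gt1 mu_law (repr s)).
  by rewrite -work_pi; exact: work_le.
rewrite expectD expect_cst; last exact: law_slot.
have := slot_load_useful lambda_gt1 mu_law k_gt0 sk s1; rewrite -natr1; lra.
Qed.

Definition total_income t S : R := \sum_(i < t) income k lambda i.+1 S.

(* The club is universally quantified because the representative of the state
   after a slot renames its chunks. *)
Lemma work_le_club t : exists2 K : R, 0 <= K &
  forall M (S : profile) s, (0 < M)%N -> (#|` S| < k)%N ->
  expect (nstep chain t s) (fun s => work s) <=
  work s - credits k t S (repr s) + t%:R * (lambda * k%:R - 1) - total_income t S +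
  K * (excess M S (repr s)).+1%:R ^+ 2 / M%:R.
Proof.
elim: t => [|t [K K0 IH]].
  exists 0 => // M S s M0 Sk; rewrite expect_ret /total_income big_ord0 !mul0r.
  by rewrite /credits big1 ?subr0 ?addr0// => X _; rewrite credit0.
exists ((4 * t.+1%:R + 50 * K) * A.+1%:R ^+ 2 + (lambda + 1) * t.+1%:R).
  have l0 : 0 <= lambda + 1 by rewrite addr_ge0// (le_trans _ (ltW lambda_gt1)).
  by rewrite addr_ge0// mulr_ge0// ?sqr_ge0// addr_ge0// mulr_ge0.
move=> M S s M0 Sk; rewrite expect_nstepS.
pose c := t%:R * (lambda * k%:R - 1) - total_income t S.
apply: (@le_trans _ _ (expect (slot k lambda A mu (repr s)) (fun y =>
    (load k y - credits k t S y + K * (excess M S y).+1%:R ^+ 2 / M%:R) + c))).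
  apply: le_expect => [|y]; first by case: (law_slot k lambda_gt1 mu_law (repr s)).
  have [S' [cS' crS' exS']] := @same_state_club R k _ _ S (same_state_repr y).
  have := IH M S' (\pi_state y)%qT M0; rewrite cS' crS' exS' work_pi => /(_ Sk).
  rewrite /c /total_income /income cS'; lra.
rewrite expectD expect_cst; last exact: law_slot.
have := slot_drift lambda_gt1 mu_law t (repr s) Sk M0 K0.
have -> : t.+1%:R * (lambda * k%:R - 1) =
    t%:R * (lambda * k%:R - 1) + (lambda * k%:R - 1) by rewrite -natr1 mulrDl mul1r.
rewrite /c /total_income big_ord_recr /=; lra.
Qed.

(** If |S| + 1 < k the total 1 + ... + T is quadratic. Otherwise, after the first k - 1 slots, each
    slot earns (lambda + 1)(k - 1), which exceeds lambda k - 1 by exactly k - lambda > 0; [T1]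
    serves the former case and [T2] the latter. Of the margin 2, one unit is the decrease aimed at
    and one absorbs the error term of [work_le_club]. *)
Lemma total_income_large : exists2 T : nat, (0 < T)%N & forall S,
  T%:R * (lambda * k%:R - 1) + 2 <= total_income T S.
Proof.
pose p := k.-1.
have kp : k%:R = p%:R + 1 :> R by rewrite natr1 prednK.
have [T1 hT1] := archi_nat (2 * (lambda * k%:R) + 4).
have [T2 hT2] := archi_nat (((lambda + 1) * p%:R ^+ 2 + 2) / (k%:R - lambda)).
pose T := (T1 + T2).+1.
have TT1 : T1%:R <= T%:R :> R by rewrite ler_nat /T; lia.
have TT2 : T2%:R <= T%:R :> R by rewrite ler_nat /T; lia.
exists T => // S; rewrite /total_income /income; case: (ltnP #|` S|.+1 k) => _.
  have H n : (n * n <= 2 * \sum_(i < n) i.+1)%N.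
    elim: n => [|n IH]; first by rewrite big_ord0.
    by rewrite big_ord_recr /=; move: (\sum_(_ < _) _)%N IH => u; nia.
  have := H T; rewrite -(ler_nat R) !natrM natr_sum.
  set s := \sum_(_ < _) _; set v := lambda * k%:R in hT1 *.
  move: (T%:R) TT1 => T' TT1.
  have : 0 <= v by rewrite mulr_ge0// (le_trans _ (ltW lambda_gt1)).
  nra.
have H n : (n * p <= \sum_(i < n) minn i.+1 p + p * minn n p)%N.
  elim: n => [|n IH]; first by rewrite big_ord0.
  rewrite big_ord_recr /=; move: (\sum_(_ < _) _)%N IH => u.
  by case: (leqP n.+1 p) => np; [rewrite (minn_idPl (ltnW np))|rewrite (minn_idPr (np : (p <= n)%N))]; nia.
have : (T * p <= \sum_(i < T) minn i.+1 p + p * p)%N.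
  apply: leq_trans (H T) _; rewrite leq_add2l leq_mul2l geq_minr orbT//.
rewrite -(ler_nat R) natrD !natrM natr_sum -mulr_sumr.
set s := \sum_(_ < _) _; move: (T%:R) TT2 => T' TT2 le_s.
have : (lambda + 1) * p%:R ^+ 2 + 2 <= T' * (k%:R - lambda).
  by rewrite -ler_pdivrMr ?subr_gt0//; exact: le_trans TT2.
have : (lambda + 1) * (T' * p%:R) <= (lambda + 1) * (s + p%:R * p%:R).
  by rewrite ler_wpM2l// addr_ge0// (le_trans _ (ltW lambda_gt1)).
rewrite kp expr2; lra.
Qed.

Lemma load_le_size x : load k x <= k%:R * (size x)%:R :> R.
Proof.
rewrite /load mulr_natr -iter_addr_0 -count_predT -big_const_seq.
by apply: ler_sum => X _; rewrite ler_nat leq_subr.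
Qed.

Lemma work_drift : exists (T : nat) (w b : R), [/\ (0 < T)%N, 0 <= b,
    forall s, expect (nstep chain T s) (fun s => work s) <= work s + b
  & forall s, active k (repr s) -> w < work s ->
      expect (nstep chain T s) (fun s => work s) <= work s - 1].
Proof.
have [T T0 incT] := total_income_large.
have [K K0 club] := work_le_club T.
(* A gain of [c] in the first slot pays for the arrivals of all [T] slots. The club obtained from
   [few_useful_club] at [2 * c] leaves at most [4 * c] outsiders; with [M] the size of the club they
   make up the whole excess, and [N0] members keep the error below 1. In [N], the summand [A] makes
   [size + A] at most twice the size. *)
have [c hc] := archi_nat (T%:R * (lambda * k%:R - 1) + 1 : R).
have [N0 hN0] := archi_nat (K * (4 * c).+1%:R ^+ 2 : R).
pose N := (A + 2 + 4 * c + N0)%N.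
have lk0 : 0 <= lambda * k%:R - 1.
  by rewrite subr_ge0 -[leLHS]mulr1 ler_pM ?ler1n// ltW.
exists T, (k%:R * N%:R), (T%:R * (lambda * k%:R - 1)); split=> //.
- by rewrite mulr_ge0.
- exact: work_le.
move=> s sk ws.
have sN : (N < size (repr s))%N.
  rewrite -(ltr_nat R) -(ltr_pM2l (_ : 0 < k%:R)) ?ltr0n//.
  exact: lt_le_trans ws (load_le_size _).
have s0 : repr s != [::] by case: (repr s) sN.
set U : R := \sum_(X <- repr s) \sum_(Y <- repr s) (~~ (Y `<=` X)%fset)%:R.
have [Uc|cU] := lerP U (2 * c * size (repr s))%:R.
  have [S Sm] := few_useful_club s0 Uc.
  have nm : (count_mem S (repr s) + count (predC1 S) (repr s) = size (repr s))%N.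
    exact: count_predC.
  pose M := count_mem S (repr s).
  have SM : (N0.+1 <= M)%N.
    rewrite /M; clear -sN nm Sm; move: sN nm Sm; rewrite /N.
    by move: (size _) (count _ _) (count _ _) => *; lia.
  have Sk : (#|` S| < k)%N.
    apply: (active_mem sk); rewrite -has_pred1 has_count; exact: leq_trans SM.
  have M0 : (0 < M)%N by exact: leq_trans SM.
  have := club M S s M0 Sk; have := incT S.
  have := credits_ge0 (R := R) k T S (repr s).
  have : K * (excess M S (repr s)).+1%:R ^+ 2 / M%:R <= 1; last lra.
  rewrite ler_pdivrMr ?ltr0n// mul1r.
  apply: (@le_trans _ _ (K * (4 * c).+1%:R ^+ 2)).
    rewrite ler_wpM2l// lerXn2r ?nnegrE// ler_nat ltnS /excess /M subnn addn0.
    by clear -Sm; move: Sm; move: (count _ _) => *; lia.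
  by apply: le_trans hN0 _; rewrite ler_nat ltnW.
have s1 : (1 < size (repr s))%N.
  by clear -sN; move: sN; rewrite /N; move: (size _) => *; lia.
have := work_le_useful T.-1 sk s1; rewrite prednK// -/U.
have : c%:R <= (size (repr s) + A)%:R^-1 * U; last lra.
rewrite mulrC ler_pdivlMr ?ltr0n; last by rewrite addn_gt0 (ltnW s1).
apply: le_trans (ltW cU); rewrite -natrM ler_nat.
by clear -sN; move: sN; rewrite /N; move: (size _) => n; nia.
Qed.

End Drift.

(** * A state reached from everywhere *)

Lemma bijection_of_uniq (s t : seq nat) : uniq s -> uniq t -> size s = size t ->
  exists2 f : nat -> nat, bijective f & map f s = t.
Proof.
elim: s t => [|c s IH] [|d t]//=; first by exists id => //; exists id.
move=> /andP[cs us] /andP[dt ut] [/(IH _ us ut)[f fb ft]].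
(* The image of [c] under [f] need not be [d]; composing with the transposition of [f c] and [d]
   corrects it and fixes the images of the entries of [s]. *)
pose swap x := if x == f c then d else if x == d then f c else x.
have swapK : involutive swap.
  move=> x; rewrite /swap; case: (eqVneq x (f c)) => [->|xc].
    by case: (eqVneq d (f c)) => [->|_]; rewrite ?eqxx.
  by case: (eqVneq x d) => [->|xd]; rewrite ?eqxx// (negPf xc) (negPf xd).
exists (swap \o f); first by apply: bij_comp => //; exact: inv_bij.
rewrite /= {1}/swap eqxx; congr (_ :: _); rewrite -[RHS]ft; apply/eq_in_map => e es /=.
rewrite /swap (bij_eq fb) (negPf (memPn cs _ es)).
by rewrite (negPf (memPn dt _ _))// -ft map_f.
Qed.

(** The labels are those pushed in successive sweeps, newest first. Each batch of [n] peers holds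
    the label of its own sweep and all later ones; departures are not yet applied. *)
Fixpoint stair (n : nat) (ls : seq nat) : config :=
  if ls is c :: ls' then [seq (c |` X)%fset | X <- stair n ls'] ++ nseq n [fset c]%fset
  else [::].

Section Stair.
Implicit Types (X Y : profile) (x y : config) (ls : seq nat).

Lemma stair_rename n (f : nat -> nat) ls : rename f (stair n ls) = stair n (map f ls).
Proof.
elim: ls => //= c ls IH; rewrite /rename map_cat map_nseq imfset_fset1 -!map_comp -IH.
by rewrite /rename -map_comp; congr (_ ++ _); apply: eq_map => X /=; rewrite imfsetU1.
Qed.

Lemma stair_cardfs n ls X : X \in stair n ls -> (#|` X| <= size ls)%N.
Proof.
elim: ls X => //= c ls IH X; rewrite mem_cat => /orP[/mapP[Y /IH Yls ->]|].
  by rewrite cardfsU1 (leq_add (leq_b1 _) Yls).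
by rewrite mem_nseq => /andP[_ /eqP ->]; rewrite cardfs1.
Qed.

Lemma stair_mem n ls c : (0 < n)%N -> c \in ls -> exists2 X, X \in stair n ls & c \in X.
Proof.
move=> n0; elim: ls => //= d ls IH; rewrite inE => /orP[/eqP ->|/IH[X Xls cX]].
  by exists [fset d]%fset; rewrite ?inE// mem_cat mem_nseq n0 eqxx orbT.
exists (d |` X)%fset; last by rewrite !inE cX orbT.
by rewrite mem_cat map_f.
Qed.

Lemma leave_rename k (f : nat -> nat) x : injective f ->
  leave k (rename f x) = rename f (leave k x).
Proof.
move=> fi; rewrite /leave /rename filter_map; congr map; apply: eq_filter => X /=.
by rewrite rename_cardfs.
Qed.

Lemma leave_cat k x y : leave k (x ++ y) = leave k x ++ leave k y.
Proof. exact: filter_cat. Qed.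

Lemma leave_addU k c x :
  leave k [seq (c |` X)%fset | X <- leave k x] = leave k [seq (c |` X)%fset | X <- x].
Proof.
rewrite /leave !filter_map -filter_predI; congr map; apply: eq_filter => X /=.
by rewrite cardfsU1; move: #|` X| => m; case: (c \notin X) => /=; lia.
Qed.

Lemma perm_leave k x y : perm_eq x y -> perm_eq (leave k x) (leave k y).
Proof. by move=> xy; exact: perm_filter. Qed.

End Stair.

Section Reachability.
Context {R : realType}.
Implicit Types (X Y : profile) (x y z : config).

Lemma mem_others y i j : (j < size y)%N -> j != i ->
  nth fset0 y j \in take i y ++ drop i.+1 y.
Proof.
move=> jy ji; rewrite mem_cat; case: (ltnP j i) => [lt_ji|le_ij].
  by rewrite -(nth_take _ lt_ji) mem_nth// size_take; case: ifP => //.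
have lt_ij : (i.+1 <= j)%N by rewrite ltn_neqAle eq_sym ji.
apply/orP; right; rewrite -[j](subnKC lt_ij) -nth_drop mem_nth// size_drop.
by rewrite ltn_sub2r//; exact: leq_ltn_trans jy.
Qed.

Lemma contact_ge y i j Z : (i < size y)%N -> (j < size y)%N -> j != i ->
  1 <= prob (download (nth fset0 y i) (nth fset0 y j)) [set Z]%classic :> R ->
  (size y)%:R^-1 <= prob (contact y i) [set Z]%classic :> R.
Proof.
move=> iy jy ji pZ; rewrite -[leLHS]mulr1.
have jo := mem_others jy ji.
apply: (@prob_bind_ge _ _ _ _ _ (nth fset0 y j)) => //.
- by case: (@law_uniform R _ (nth fset0 y i) (take i y ++ drop i.+1 y)).
- by move=> Y; case: (@law_download R (nth fset0 y i) Y).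
apply: le_trans (prob_uniform_ge _ jo).
have o0 : (0 < size (take i y ++ drop i.+1 y))%N by case: (_ ++ _) jo.
rewrite lef_pV2 ?posrE ?ltr0n//; last exact: leq_ltn_trans iy.
by rewrite ler_nat size_cat size_take size_drop iy; move: iy; move: (size y) => n; lia.
Qed.

Lemma Forall2_map (I T U : Type) (P : T -> U -> Prop) (f : I -> T) (g : I -> U) s :
  (forall i, P (f i) (g i)) -> List.Forall2 P [seq f i | i <- s] [seq g i | i <- s].
Proof. by move=> H; elim: s => [|i s IH]; constructor. Qed.

Lemma Forall2_map_in (I : eqType) (T U : Type) (P : T -> U -> Prop) (f : I -> T)
    (g : I -> U) s : {in s, forall i, P (f i) (g i)} ->
  List.Forall2 P [seq f i | i <- s] [seq g i | i <- s].
Proof.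
elim: s => [|i s IH] H; constructor; first by apply: H; rewrite mem_head.
by apply: IH => j js; apply: H; rewrite inE js orbT.
Qed.

(* Everybody but the carrier of [c] selects that carrier; the carrier itself
   selects an empty peer. *)
Lemma exchange_ge y c i j : (i < size y)%N -> (j < size y)%N -> i != j ->
  nth fset0 y i = [fset c]%fset -> nth fset0 y j = fset0 ->
  (forall l, (l < size y)%N -> l != i -> c \notin nth fset0 y l) ->
  (size y)%:R^-1 ^+ size y <=
  prob (exchange y) [set [seq (c |` X)%fset | X <- y]]%classic :> R.
Proof.
move=> iy jy ij yi yj cy.
have -> : [seq (c |` X)%fset | X <- y] =
          [seq (c |` nth fset0 y l)%fset | l <- iota 0 (size y)].
  by rewrite -[in LHS](mkseq_nth fset0 y) -map_comp.
rewrite -{2}(size_iota 0 (size y)) -(size_map (@contact R y)).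
apply: prob_independent_ge => //; first last.
  move=> d dy; suff [] : is_law d by [].
  by apply: law_independent_map dy => l; exact: law_contact.
apply: Forall2_map_in => l; rewrite mem_iota add0n => /andP[_ ly].
case: (eqVneq l i) => [->|li].
  apply: (contact_ge iy jy); first by rewrite eq_sym.
  rewrite yi yj /download fset0D /uniform /= prob_ret.
  by rewrite fsetUid in_set1_refl.
apply: (contact_ge ly iy); first by rewrite eq_sym.
rewrite yi /download; have -> : ([fset c] `\` nth fset0 y l = [fset c])%fset.
  by apply/fsetDidPl; rewrite fdisjoint1X; exact: cy.
have cX : (c |` nth fset0 y l)%fset \in [seq (c0 |` nth fset0 y l)%fset | c0 <- [fset c]%fset].
  by apply/mapP; exists c; rewrite ?inE.
have := @prob_uniform_ge R _ (nth fset0 y l) _ _ cX.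
by rewrite size_map [size _](cardfs1 c) invr1.
Qed.

Lemma arrival_likely (lambda : R) A mu : arrival_law lambda A mu ->
  exists2 n, (1 < n < A)%N & 0 < mu n.
Proof.
case=> mu0 muA mu1 _.
have /existsP[n mun] : [exists n : 'I_A, mu n != 0].
  apply/existsPn => mu_eq0; have := @oner_neq0 R; rewrite -mu1 big1 ?eqxx// => n _.
  by apply/eqP; move: (mu_eq0 n); rewrite negbK.
by exists n; [exact: muA|rewrite lt_neqAle eq_sym mun mu0].
Qed.

End Reachability.

Section Staircase.
Context {R : realType}.
Variables (k : nat) (lambda : R) (A : nat) (mu : nat -> R).
Hypothesis lambda_gt1 : 1 < lambda.
Hypothesis mu_law : arrival_law lambda A mu.
Hypothesis k_gt1 : (1 < k)%N.
Implicit Types (X Y : profile) (x y z : config).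

Local Notation chain := (p2p_chain k lambda A mu).

Let lambda_gt0 : 0 < lambda. Proof. exact: lt_trans lambda_gt1. Qed.

Variable n : nat.
Hypothesis n_gt1 : (1 < n)%N.
Hypothesis n_ltA : (n < A)%N.
Hypothesis mun_gt0 : 0 < mu n.

(** As n > 1, the batch contains an empty peer besides the carrier of [c]; this is the peer that the
    carrier selects in [exchange_ge]. *)
Let batch (c : nat) : config := [seq if i == 0%N then [fset c]%fset else fset0 | i <- iota 0 n].

Let size_batch c : size (batch c) = n. Proof. by rewrite size_map size_iota. Qed.

Let nth_batch c i : (i < n)%N ->
  nth fset0 (batch c) i = if i == 0%N then [fset c]%fset else fset0.
Proof. by move=> ltin; rewrite (nth_map 0%N) ?size_iota// nth_iota. Qed.

Let batchU c : [seq (c |` X)%fset | X <- batch c] = nseq n [fset c]%fset.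
Proof.
rewrite -map_comp -[n in RHS](size_iota 0); elim: (iota 0 n) => //= i l ->.
by case: (i == 0%N); rewrite ?fsetUid ?fsetU0.
Qed.

(* The outcome of a slot in which the server pushes a single chunk, which
   everybody gets. *)
Definition sweep x : config :=
  leave k ([seq (fresh x |` X)%fset | X <- x] ++ nseq n [fset fresh x]%fset).

Let newcomers_ge x : (Num.min lambda^-1 ((lambda - 1) / lambda)) ^+ n <=
  prob (newcomers lambda x n) [set batch (fresh x)]%classic.
Proof.
rewrite -[in leLHS](size_iota 0 n) -(size_map (fun i => newcomer lambda (fresh x + i)%N)).
apply: prob_independent_ge; first by rewrite le_min invr_ge0 divr_ge0 ?subr_ge0// ltW.
- apply: Forall2_map => i; rewrite /prob expect_newcomer//.
  case: (eqVneq i 0%N) => [->|i0].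
    rewrite addn0 in_set1_refl ge_min; apply/orP; left.
    by rewrite mulrDl mul1r lerDl divr_ge0 ?mulr_ge0 ?subr_ge0// ltW.
  rewrite in_set1_refl ge_min; apply/orP; right.
  by rewrite mulr1 ler_pM2r ?invr_gt0// lerDr.
by move=> d; move/law_independent_map => -[] // i; exact: law_newcomer.
Qed.

Lemma sweep_likely : exists2 eta : nat -> R, forall m, 0 < eta m &
  forall x m, (size x <= m)%N ->
    eta m <= prob (slot k lambda A mu x) [set sweep x]%classic.
Proof.
pose q := Num.min lambda^-1 ((lambda - 1) / lambda).
have q0 : 0 < q by rewrite /q lt_min invr_gt0 divr_gt0 ?subr_gt0 ?lambda_gt0.
(* The factors bound the probabilities of [n] arrivals, of the prescribed coin tosses, and of the
   prescribed contacts, each of at most m + n peers making its own with probability at least 1 / (m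
   + n). The last factor is the deterministic departure. *)
exists (fun m => mu n * (q ^+ n * ((m + n)%:R^-1 ^+ (m + n) * 1))) => [m|x m xm].
  have mn : (0 : R) < (m + n)%:R by rewrite ltr0n; lia.
  by rewrite mulr1 !mulr_gt0// exprn_gt0// invr_gt0.
set c := fresh x; set s := batch c.
have law_n s' : is_law (bind (exchange (leave k (x ++ s'))) (fun z => ret (leave k z)) : fdist R config).
  by apply: law_bind => [|z]; [exact: law_exchange|exact: law_ret].
have ge0 m' : 0 <= ((m' + n)%:R^-1 ^+ (m' + n) * 1 : R) by rewrite mulr1 exprn_ge0.
have yE : leave k (x ++ s) = leave k x ++ s.
  rewrite leave_cat; congr (_ ++ _); apply/all_filterP/allP => X /mapP[i _ ->].
  by case: ifP => _; rewrite ?cardfs1 ?cardfs0//; lia.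
have sx : (size (leave k x) <= size x)%N by rewrite size_filter count_size.
apply: (@prob_bind_ge _ _ _ _ _ n).
- by case: (law_arrivals mu_law).
- move=> n'; case: (law_bind (law_newcomers lambda_gt1 x n') law_n) => //.
- by rewrite mulr_ge0// exprn_ge0// ltW.
- rewrite /prob /expect big_map (bigD1_seq n) ?iota_uniq ?mem_iota//= in_set1_refl mulr1.
  by rewrite lerDl sumr_ge0// => i _; rewrite mulr_ge0//; case: mu_law.
apply: (@prob_bind_ge _ _ _ _ _ s) => //.
- by case: (law_newcomers lambda_gt1 x n).
- by move=> s'; case: (law_n s').
rewrite yE; set y := leave k x ++ s.
apply: (@prob_bind_ge _ _ _ _ _ [seq (c |` X)%fset | X <- y]) => //.
- by case: (@law_exchange R y).
- by move=> z; case: (@law_ret R _ (leave k z)).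
- have sy : size y = (size (leave k x) + n)%N by rewrite size_cat size_batch.
  have y0 : (0 < size y)%N by rewrite sy; lia.
  apply: (@le_trans _ _ ((size y)%:R^-1 ^+ size y)).
    apply: (@le_trans _ _ ((m + n)%:R^-1 ^+ size y)).
      apply: ler_wiXn2l; first by rewrite invr_ge0.
      + by rewrite invf_le1 ?ltr0n ?ler1n; lia.
      by rewrite sy; lia.
    rewrite lerXn2r ?nnegrE ?invr_ge0// lef_pV2 ?posrE ?ltr0n//; last lia.
    by rewrite ler_nat sy; lia.
  have nthy l : nth fset0 y l = if (l < size (leave k x))%N then nth fset0 (leave k x) l
                                else nth fset0 s (l - size (leave k x)).
    exact: nth_cat.
  apply: (@exchange_ge _ y c (size (leave k x)) (size (leave k x)).+1).
  + by rewrite sy; lia.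
  + by rewrite sy; lia.
  + by rewrite neq_ltn ltnSn.
  + by rewrite nthy ltnn subnn nth_batch//; lia.
  + by rewrite nthy ltnNge leqnSn subSnn nth_batch//.
  move=> l ly li; rewrite nthy; case: ltnP => lx.
    apply/negP => cl; have : nth fset0 (leave k x) l \in x.
      by move: (mem_nth fset0 lx); rewrite mem_filter => /andP[].
    by move/mem_fresh => /(_ _ cl); rewrite ltnn.
  by rewrite nth_batch ?subn_eq0 ?inE; [case: leqP => //|]; lia.
rewrite prob_ret (_ : (_ \in _) = true) ?lexx//; apply: mem_set => /=.
by rewrite /sweep /y map_cat !leave_cat leave_addU batchU.
Qed.

Lemma size_sweep x : (size (sweep x) <= size x + n)%N.
Proof.
rewrite /sweep size_filter; apply: leq_trans (count_size _ _) _.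
by rewrite size_cat size_map size_nseq.
Qed.

(* After [t] sweeps every initial peer has left or holds at least [t] chunks,
   and the peers that arrived since form a staircase. *)
Definition swept t x := exists (a : config) (ls : seq nat),
  [/\ all (fun X : profile => t <= #|` X|)%N a, uniq ls, size ls = t
    & perm_eq (leave k x) (leave k (a ++ stair n ls))].

Lemma swept0 x : swept 0 x.
Proof. by exists x, [::]; split=> //; [apply/allP|rewrite cats0]. Qed.

Lemma swept_same_state t x y : same_state x y -> swept t x -> swept t y.
Proof.
move=> /same_stateP[f fi xy] [a [ls [ta uls sls px]]].
exists (rename f a), (map f ls); split.
- by rewrite all_map; apply: sub_all ta => X /=; rewrite rename_cardfs.
- by rewrite map_inj_uniq.
- by rewrite size_map.
rewrite -stair_rename /rename -map_cat -/(rename f _) leave_rename//.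
rewrite -(permPl (perm_leave k xy)) leave_rename//; exact: perm_map.
Qed.

(** The pushed label is held by no remaining peer, so each of them gains a chunk; an initial peer
    that already left has at least k > t chunks. *)
Lemma swept_sweep t x : (t < k)%N -> swept t x -> swept t.+1 (sweep x).
Proof.
move=> tk [a [ls [ta uls sls px]]]; set c := fresh x.
have memx X : (#|` X| < k)%N -> X \in a ++ stair n ls -> X \in x.
  move=> Xk Xa; have : X \in leave k x by rewrite (perm_mem px) mem_filter Xk.
  by rewrite mem_filter => /andP[].
have cX X : (#|` X| < k)%N -> X \in a ++ stair n ls -> c \notin X.
  move=> Xk /(memx _ Xk) Xx; apply/negP => /(mem_fresh Xx); by rewrite ltnn.
exists [seq (c |` X)%fset | X <- a], (c :: ls); split.
- rewrite all_map; apply/allP => X Xa /=; rewrite cardfsU1.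
  case: (leqP k #|` X|) => Xk; first exact: leq_trans tk (leq_trans Xk (leq_addl _ _)).
  rewrite cX ?mem_cat ?Xa//; exact: (allP ta).
(* Were [c] already a label, some profile of the staircase would hold it; with at most t < k chunks
   its peer is still present, against freshness. *)
- rewrite /= uls andbT; apply/negP => cls.
  have [X Xls cX'] := stair_mem (ltnW n_gt1) cls.
  have Xk : (#|` X| < k)%N.
    by apply: leq_ltn_trans (stair_cardfs Xls) _; rewrite sls.
  by move: (cX X Xk); rewrite mem_cat Xls orbT cX' => /(_ isT).
- by rewrite /= sls.
rewrite (leave_active (active_leave k _)) /= catA -map_cat [X in perm_eq X _]leave_cat.
rewrite [X in perm_eq _ X]leave_cat perm_cat2r -leave_addU -[X in perm_eq _ X]leave_addU.
by apply: perm_leave; exact: perm_map.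
Qed.

(** All initial peers have left, so what remains is a staircase determined by k distinct labels, and
    two such lists of labels differ by a renaming. *)
Lemma swept_unique x y : active k x -> active k y -> swept k x -> swept k y -> same_state x y.
Proof.
have H z ls a : active k z -> all (fun X : profile => k <= #|` X|)%N a ->
    perm_eq (leave k z) (leave k (a ++ stair n ls)) -> perm_eq z (leave k (stair n ls)).
  move=> zk ka; rewrite leave_active// leave_cat (_ : leave k a = [::])//.
  apply/eqP; rewrite -[_ == _]negbK -has_filter -all_predC.
  by apply: sub_all ka => X /=; rewrite -leqNgt.
move=> xk yk [a [ls [ka uls sls /(H _ _ _ xk ka) px]]] [b [ms [kb ums sms /(H _ _ _ yk kb) py]]].
have [f fb fls] := bijection_of_uniq uls ums (etrans sls (esym sms)).
apply/asboolP; exists f => //; rewrite (permPr py) -fls -stair_rename leave_rename; last exact: bij_inj.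
exact: perm_map.
Qed.

Lemma swept_likely t : (t <= k)%N -> exists2 delta : nat -> R, forall m, 0 < delta m &
  forall s m, (size (repr s) <= m)%N -> exists s' : state,
  [/\ swept t (repr s'), (size (repr s') <= m + t * n)%N, (0 < t)%N -> active k (repr s')
    & delta m <= prob (nstep chain t s) [set s']%classic].
Proof.
have [eta eta0 eta_le] := sweep_likely.
elim: t => [|t IH] tk.
  exists (fun=> 1) => // s m sm; exists s; split=> //; first exact: swept0.
    by rewrite addn0.
  by rewrite prob_ret in_set1_refl.
have [delta delta0 delta_le] := IH (ltnW tk).
exists (fun m => delta m * eta (m + t * n)%N) => [m|s m sm]; first exact: mulr_gt0.
have [s' [sw sz _ ps']] := delta_le s m sm.
have law_c := law_chain k lambda_gt1 mu_law.
have rs := same_state_repr (sweep (repr s')).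
exists (\pi_state (sweep (repr s')))%qT; split.
- by apply: swept_same_state rs _; exact: swept_sweep.
- have /same_stateP[f _ /perm_size] := rs; rewrite size_map => <-.
  by apply: leq_trans (size_sweep _) _; rewrite mulSn; lia.
- by move=> _; rewrite -(same_state_active k rs); exact: active_leave.
rewrite -addn1; apply: (@prob_nstepD _ _ _ law_c _ _ _ s') => //; first exact: ltW.
rewrite /prob expect_nstep /= /transition -/(prob _ _) -[leLHS]mulr1.
apply: (@prob_bind_ge _ _ _ _ _ (sweep (repr s'))) => //.
- by case: (law_slot k lambda_gt1 mu_law (repr s')).
- by move=> z; case: (@law_ret R _ (\pi_state z)%qT).
- exact: eta_le.
by rewrite prob_ret in_set1_refl.
Qed.

End Staircase.

Lemma reference_state (R : realType) k (lambda : R) A mu : 1 < lambda ->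
    arrival_law lambda A mu -> (1 < k)%N ->
  exists z : state, exists2 delta : nat -> R, forall m, 0 < delta m &
    forall s m, (size (repr s) <= m)%N ->
      delta m <= prob (nstep (p2p_chain k lambda A mu) k s) [set z]%classic.
Proof.
move=> lambda_gt1 mu_law k_gt1.
have [n /andP[n_gt1 n_ltA] mun] := arrival_likely mu_law.
have [delta delta0 reach] :=
  swept_likely lambda_gt1 mu_law k_gt1 n_gt1 n_ltA mun (leqnn k).
(* The empty system supplies the reference state; by [swept_unique], k sweeps from any other state
   end in the same one. *)
have [z [zk _ za _]] := reach (\pi_state [::])%qT _ (leqnn _).
exists z, delta => // s m sm; have [s' [sk _ sa]] := reach s m sm.
suff -> : s' = z by [].
rewrite -[s']reprK -[z]reprK; apply/eqmodP.
by apply: swept_unique sk zk; [apply: sa|apply: za]; exact: ltnW.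
Qed.

Theorem corollaryV1 (R : realType) (lambda : R) (hlambda : 1 < lambda) :
  exists2 k : nat, (0 < k)%N &
    forall (A : nat) (mu : nat -> R),
      arrival_law lambda A mu -> stable k lambda A mu.
Proof.
(* Any k above [lambda] works; the form [m.+1] also matches the number of steps in the Foster
   criterion. *)
have [m lambda_le_m] := archi_nat lambda.
exists m.+1 => // A mu mu_law.
have lambda_lt : lambda < m.+1%:R by apply: le_lt_trans lambda_le_m _; rewrite ltr_nat.
have k_gt1 : (1 < m.+1)%N by rewrite -(ltr_nat R) (lt_trans hlambda).
set k := m.+1 in lambda_lt k_gt1 *.
have law_c := law_chain k hlambda mu_law.
have [T [w [b [T0 b0 work_b work_w]]]] := work_drift hlambda mu_law lambda_lt.
have [z [delta delta0 reach]] := reference_state hlambda mu_law k_gt1.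
have [N wN] := archi_nat w.
(* The drift of the work is known only from active states. The penalty [b + 1] on the other states
   disappears after one slot, since every slot ends with [leave], and this yields a decrease by 1
   from them too. *)
pose V (s : state) : R := load k (repr s) + if active k (repr s) then 0 else b + 1.
pose F : set state := [set s | active k (repr s) /\ load k (repr s) <= w]%classic.
have V_work s : expect (nstep (p2p_chain k lambda A mu) T s) V <=
    expect (nstep (p2p_chain k lambda A mu) T s) (fun s => load k (repr s)).
  rewrite -(prednK T0) -addn1 !expect_nstepD//.
  apply: le_expect => [|s']; first by case: (law_nstep law_c T.-1 s).
  rewrite !expect_nstep /= /transition.
  apply: (@le_expect_on _ _ (fun s => active k (repr s))) => [||s'' ak].
  - by case: (law_c s').
  - apply: (@surely_bind _ _ _ (active k)) => [|y yk].
      apply: (@surely_bind _ _ _ predT) => [|n _]; first exact: all_predT.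
      apply: (@surely_bind _ _ _ predT) => [|x _]; first exact: all_predT.
      apply: (@surely_bind _ _ _ predT) => [|x' _]; first exact: all_predT.
      by rewrite /surely /= active_leave.
    by rewrite /surely /= -(same_state_active k (same_state_repr y)) yk.
  by rewrite /V ak addr0.
apply: (@foster_positive_recurrent R state _ T m V F (b + 1) (delta N) z) => //.
- move=> s; rewrite addr_ge0 ?load_ge0//; case: ifP => // _.
  by rewrite addr_ge0.
- by rewrite addr_ge0.
- move=> s; apply: le_trans (V_work s) _; rewrite /V.
  case: (boolP (active k (repr s))) => ak; last first.
    have := work_b s; have : 0 <= (b + 1) * (s \in F)%:R by rewrite mulr_ge0// addr_ge0.
    lra.
  rewrite addr0; case: (lerP (load k (repr s)) w) => le_w.
    rewrite (_ : (s \in F) = true); last by apply: mem_set.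
    by rewrite mulr1; have := work_b s; lra.
  apply: le_trans (work_w s ak le_w) _.
  by rewrite lerDl mulr_ge0// addr_ge0.
- move=> s [ak le_w]; apply: reach.
  (* Each peer of an active state misses at least one chunk, so the load bounds the number of
     peers. *)
  rewrite -(ler_nat R); apply: le_trans (le_trans le_w wN).
  rewrite -sum1_size natr_sum /load big_seq [leRHS]big_seq; apply: ler_sum => X Xs.
  by rewrite ler_nat subn_gt0 (active_mem ak).
move=> s; exists k; apply: lt_le_trans (delta0 (size (repr s))) _; exact: reach.
Qed.
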